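(* Let $N\in\mathbb N$ (nonharmonic bandwidth), let $N_1=\sigma_1N\in2\mathbb N$ with $\sigma_1\in[\frac54,2]$, let $m_1\in\mathbb N\setminus\{1\}$ with $2m_1<N_1$, let $N_2=\sigma_2(N_1+2m_1)\in2\mathbb N$ with $\sigma_2\in[\frac54,2]$, and let $m_2\in\mathbb N\setminus\{1\}$ with $2m_2\le\big(1-\frac1{\sigma_1}\big)N_2$. Assume $m_2\ge m_1$. Let $\varphi_{\sinh,1},\varphi_{\sinh,2}$ be the $\sinh$-type window functions $$\varphi_{\sinh,j}(t)=\omega_{\sinh,j}\Big(\frac{N_jt}{m_j}\Big),\qquad \omega_{\sinh,j}(x)=\begin{cases}\dfrac{\sinh\big(\beta_j\sqrt{1-x^2}\big)}{\sinh\beta_j}&x\in[-1,1],\\0&\text{otherwise},\end{cases}\qquad\beta_j=2\pi m_j\Big(1-\frac1{2\sigma_j}\Big).$$ Let $M_1,M_2\in2\mathbb N$, let $x_j\in[-\frac12,\frac12]$, $j\in\mathcal I_{M_2}$, be arbitrary nodes, $f_k\in\mathbb C$, $k\in\mathcal I_{M_1}$, arbitrary coefficients, and $a=1+\frac{2m_1}{N_1}$. Then for the exponential sum $f(x)=\sum_{k\in\mathcal I_{M_1}}f_k\,\mathrm e^{-2\pi\mathrm iNv_kx}$ with arbitrary $v_k\in[-\frac1{2a},\frac1{2a}]$, $k\in\mathcal I_{M_1}$, the error of the NNFFT with windows $\varphi_{\sinh,1}$, $\varphi_{\sinh,2}$ satisfies $$\max_{j\in\mathcal I_{M_2}}\Big|f(x_j)-\frac{s_1(Nx_j)}{\hat\varphi_{\sinh,1}(Nx_j)}\Big|\le\max_{x\in[-1/2,1/2]}\Big|f(x)-\frac{s_1(Nx)}{\hat\varphi_{\sinh,1}(Nx)}\Big|\le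 E(\varphi_{\sinh})\sum_{k\in\mathcal I_{M_1}}|f_k|,$$ where $$E(\varphi_{\sinh})=(24m_1^{3/2}+10)\,\mathrm e^{-2\pi m_1\sqrt{1-1/\sigma_1}}+(24m_2^{3/2}+10)\,\frac{2N_1+4m_1}{\sqrt{2m_1\pi}}\,\mathrm e^{2\pi m_1(1-\sqrt{1-1/\sigma_1}-1/(2\sigma_1))}\,\mathrm e^{-2\pi m_2\sqrt{1-1/\sigma_2}}.$$
   Context: $\mathbb N$ is the set of positive integers. For $M\in2\mathbb N$, $\mathcal I_M=\{-\frac M2,1-\frac M2,\dots,\frac M2-1\}$. The Fourier transform is $\hat g(v)=\int_{\mathbb R}g(x)\mathrm e^{-2\pi\mathrm ivx}\,\mathrm dx$. NNFFT with window functions $\varphi_1,\varphi_2$ (here $\varphi_j=\varphi_{\sinh,j}$): given coefficients $f_k$ and frequencies $v_k$, set $$g_\ell=\frac1{N_1}\sum_kf_k\,\varphi_1\Big(\frac\ell{N_1}-v_k\Big)\quad(\ell\in\mathcal I_{N_1+2m_1}),\qquad h_s=\frac1{N_2}\sum_{\ell\in\mathcal I_{N_1+2m_1}}\frac{g_\ell}{\hat\varphi_2(\ell)}\mathrm e^{-2\pi\mathrm i\ell s/N_2}\quad(s\in\mathcal I_{N_2}),$$ $$s_1(Nx)=\sum_{s\in\mathcal I_{N_2}}h_s\,\varphi_2\Big(\frac x{\sigma_1}-\frac s{N_2}\Big),\qquad x\in[-\tfrac12,\tfrac12].$$ The NNFFT approximates $f(x)$ by $s_1(Nx)/\hat\varphi_1(Nx)$.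 *)

(* Defs.v *)
From HB Require Import structures.
From mathcomp Require Export all_boot all_order all_algebra.
From mathcomp Require Export complex.
From mathcomp Require Export all_classical all_reals all_analysis.

Set Implicit Arguments.
Unset Strict Implicit.
Unset Printing Implicit Defensive.

Import Order.TTheory GRing.Theory Num.Theory.

Local Open Scope classical_set_scope.
Local Open Scope ring_scope.
Local Open Scope complex_scope.

(* I_ M = {-M/2, 1 - M/2, ..., M/2 - 1}; used with M even. *)
Definition I_ (M : nat) : seq int :=
  [seq i%:Z - (M./2)%:Z | i <- iota 0 M].

Definition is_max (R : realType) (A : set R) (M : R) : Prop :=
  A M /\ ubound A M.

(* The library norm `|z| of z : R[i] lives in R[i]; normc is its R-valued
   counterpart. *)
Definition cabs (R : realType) (z : R[i]) : R := ComplexField.Normc.normc z.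

(* expi t = e^(i t) *)
Definition expi (R : realType) (t : R) : R[i] := cos t +i* sin t.

Definition Cintegral (R : realType) (F : R -> R[i]) : R[i] :=
  (\int[@lebesgue_measure R]_(x in setT) complex.Re (F x)) +i*
  (\int[@lebesgue_measure R]_(x in setT) complex.Im (F x)).

Definition fourier (R : realType) (g : R -> R[i]) (v : R) : R[i] :=
  Cintegral (fun x : R => g x * expi (- (2 * pi * v * x))).

Definition hat (R : realType) (phi : R -> R) : R -> R[i] :=
  fourier (fun t => (phi t)%:C).

Definition sinh (R : realType) (x : R) : R := (expR x - expR (- x)) / 2.

Definition beta (R : realType) (m : nat) (sigma : R) : R :=
  2 * pi * m%:R * (1 - 1 / (2 * sigma)).

Definition omega_sinh (R : realType) (m : nat) (sigma x : R) : R :=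
  if -1 <= x <= 1 then
    sinh (beta m sigma * Num.sqrt (1 - x ^+ 2)) / sinh (beta m sigma)
  else 0.

Definition phi_sinh (R : realType) (N m : nat) (sigma t : R) : R :=
  omega_sinh m sigma (N%:R * t / m%:R).

Section NNFFT.
Context {R : realType}.
Variables (phi1 phi2 : R -> R) (N N1 N2 m1 M1 : nat) (sigma1 : R).
Variables (f : int -> R[i]) (v : int -> R).

Definition exp_sum (x : R) : R[i] :=
  \sum_(k <- I_ M1) f k * expi (- (2 * pi * N%:R * v k * x)).

Definition nnfft_g (l : int) : R[i] :=
  N1%:R^-1 * \sum_(k <- I_ M1) f k * (phi1 (l%:~R / N1%:R - v k))%:C.

Definition nnfft_h (s : int) : R[i] :=
  N2%:R^-1 * \sum_(l <- I_ (N1 + 2 * m1))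
    nnfft_g l / hat phi2 l%:~R * expi (- (2 * pi * l%:~R * s%:~R / N2%:R)).

(* nnfft_s1N x is the value s_1(N x). *)
Definition nnfft_s1N (x : R) : R[i] :=
  \sum_(s <- I_ N2) nnfft_h s * (phi2 (x / sigma1 - s%:~R / N2%:R))%:C.

Definition nnfft_error (x : R) : R :=
  cabs (exp_sum x - nnfft_s1N x / hat phi1 (N%:R * x)).

End NNFFT.

Definition E_sinh (R : realType) (N1 m1 m2 : nat) (sigma1 sigma2 : R) : R :=
  (24 * m1%:R `^ (3 / 2) + 10) *
    expR (- (2 * pi * m1%:R * Num.sqrt (1 - 1 / sigma1)))
  + (24 * m2%:R `^ (3 / 2) + 10) *
    ((2 * N1%:R + 4 * m1%:R) / Num.sqrt (2 * m1%:R * pi)) *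
    expR (2 * pi * m1%:R *
            (1 - Num.sqrt (1 - 1 / sigma1) - 1 / (2 * sigma1))) *
    expR (- (2 * pi * m2%:R * Num.sqrt (1 - 1 / sigma2))).

(* Main.v *)
Require Import Defs.
From mathcomp Require Import all_boot all_order all_algebra complex.
From mathcomp Require Import all_classical all_reals all_analysis.
From mathcomp Require Import ring lra zify.
Import Order.TTheory GRing.Theory Num.Theory.
Import numFieldNormedType.Exports.

Set Implicit Arguments.
Unset Strict Implicit.
Unset Printing Implicit Defensive.

Local Open Scope classical_set_scope.
Local Open Scope ring_scope.

(** The error of the NNFFT is the sum of the errors of two quadrature rules, and
    both are instances of one fact. Let [W y = omega_sinh (y / m)], with Fourier
    transform [A] ([wft]). The sum of [W (l - t) exp (- 2 pi i w l)] over the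
    integers [l] is, by Poisson summation, [A w exp (- 2 pi i w t)] plus
    contributions of the aliases [A (w + r)], [r <> 0]. The lemma
    [window_quadrature] bounds their total by [eps * A w] with
    [eps = (24 m^(3/2) + 10) exp (- 2 pi m sqrt (1 - 1 / sigma))] whenever
    [|w| <= 1 / (2 sigma)].

    Two ingredients give it. First, the Poisson summation inequality
    ([fourier_dist_mean], [poisson_real]): a continuous periodic function differs
    from its mean by at most the sum of the moduli of its other Fourier
    coefficients, as integration against the Fejer kernel shows.

    Second, the size of [A]. Classically [A xi] is a constant times
    [I_1 (s) / s] with [s^2 = beta^2 - (2 pi m xi)^2], and [J_1 (z) / z] once
    this number is a negative [- z^2]. Instead of Bessel functions, the proof
    works with the integral [wint b a] of [sqrt (1 - x^2) sinhc (b (1 - x^2))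
    cos (a x)] over [[-1, 1]], where [sinhc (t^2) = sinh t / t]. The differential
    equation of [sinhc] makes this integral constant along the parabolas
    [b = c + a^2] ([wintE]). Moving to [a = 0] removes the oscillation for
    [|xi| <= 1 / (2 sigma)], and a Jensen-type argument on the moments of the
    half circle gives a sharp exponential lower bound ([wint0_ge_exp]). Moving to
    [b = 0] for the aliases leaves the integral of [sqrt (1 - x^2) cos (z x)],
    which is at most [pi / 2] and decays like [8 z^(-3/2)]
    ([normr_wint_neg_decay]). The nearest alias can sit at [z = 0]; all the others
    together contribute [O (m^(-3/2))], and the constants [24] and [10] leave room
    for this ([wft_aliasing]).

    In the second step of the NNFFT the quadrature error is multiplied by the
    coefficients [g_l] and divided by [A1]. At most [2 m1 + 1] of the [g_l]
    receive a contribution from a given frequency, and [wft_ge] bounds [A1] from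
    below by [sqrt m1 exp (s0 - beta)]; this produces the second summand of the
    bound ([step_factor]). The maxima exist because the error is continuous on
    the compact interval: the denominator [A1] does not vanish there. *)

(** * Pointwise rules for continuity and derivation *)

Section PointwiseRules.
Context {R : realType}.
Implicit Types (f g : R -> R) (x a b c : R).

Lemma contD f g : continuous f -> continuous g ->
  continuous (fun x => f x + g x).
Proof. by move=> cf cg x; apply: cvgD; [exact: cf|exact: cg]. Qed.

Lemma contN f : continuous f -> continuous (fun x => - f x).
Proof. by move=> cf x; apply: cvgN; exact: cf. Qed.

Lemma contM f g : continuous f -> continuous g ->
  continuous (fun x => f x * g x).
Proof. by move=> cf cg x; apply: cvgM; [exact: cf|exact: cg]. Qed.

Lemma contX f n : continuous f -> continuous (fun x => f x ^+ n).
Proof.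
move=> cf; elim: n => [|n IH].
  by under eq_fun do rewrite expr0; exact: cst_continuous.
by under eq_fun do rewrite exprS; exact: contM.
Qed.

Lemma cont_comp f g : continuous g -> continuous f ->
  continuous (fun x => g (f x)).
Proof. by move=> cg cf x; apply: continuous_comp; [exact: cf|exact: cg]. Qed.

Lemma contc c : continuous (fun _ : R => c).
Proof. by move=> x; exact: cst_continuous. Qed.

Lemma contid : continuous (fun x : R => x).
Proof. by move=> x; exact: cvg_id. Qed.

Lemma cont_sum (I : Type) (s : seq I) (F : I -> R -> R) :
  (forall i, continuous (F i)) -> continuous (fun x => \sum_(i <- s) F i x).
Proof.
move=> cF; elim: s => [|i s IH].
  by under eq_fun do rewrite big_nil; exact: contc.
by under eq_fun do rewrite big_cons; apply: contD.
Qed.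

Lemma derD f g x a b : is_derive x 1 f a -> is_derive x 1 g b ->
  is_derive x 1 (fun y => f y + g y) (a + b).
Proof. by move=> *; exact: is_deriveD. Qed.

Lemma derN f x a : is_derive x 1 f a -> is_derive x 1 (fun y => - f y) (- a).
Proof. by move=> *; exact: is_deriveN. Qed.

Lemma derM f g x a b : is_derive x 1 f a -> is_derive x 1 g b ->
  is_derive x 1 (fun y => f y * g y) (f x * b + g x * a).
Proof. by move=> *; exact: is_deriveM. Qed.

Lemma derX f n x a : is_derive x 1 f a ->
  is_derive x 1 (fun y => f y ^+ n) (n%:R * f x ^+ n.-1 * a).
Proof.
move=> df; case: n => [|n].
  by rewrite !mul0r; under eq_fun do rewrite expr0; exact: is_derive_cst.
elim: n => [|n IH].
  by under eq_fun do rewrite expr1; rewrite expr0 !mul1r.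
under eq_fun do rewrite exprS.
apply: is_derive_eq (derM df IH) _.
rewrite /= !exprS -(natr1 n.+1). ring.
Qed.

Lemma der_comp g f x a b : is_derive (f x) 1 g a -> is_derive x 1 f b ->
  is_derive x 1 (fun y => g (f y)) (a * b).
Proof. by move=> *; exact: is_derive1_comp. Qed.

Lemma derV f x a : f x != 0 -> is_derive x 1 f a ->
  is_derive x 1 (fun y => (f y)^-1) (- (f x) ^- 2 * a).
Proof. by move=> *; exact: is_deriveV. Qed.

Lemma derc c x : is_derive x 1 (fun _ : R => c) 0.
Proof. exact: is_derive_cst. Qed.

Lemma derid x : is_derive x 1 (fun y : R => y) 1.
Proof. exact: is_derive_id. Qed.

Lemma der_cont f (f' : R -> R) : (forall x, is_derive x 1 f (f' x)) ->
  continuous f.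
Proof. by move=> df x; have [+ _] := df x => /derivable1_diffP/differentiable_continuous. Qed.

Lemma expR_cont : continuous (@expR R).
Proof. by apply: der_cont => x; exact: is_derive_expR. Qed.

Lemma cos_cont : continuous (@cos R).
Proof. by apply: der_cont => x; exact: is_derive_cos. Qed.

Lemma sin_cont : continuous (@sin R).
Proof. by apply: der_cont => x; exact: is_derive_sin. Qed.

Lemma sqrt_cont : continuous (@Num.sqrt R).
Proof. exact: sqrt_continuous. Qed.

Lemma der_eq f x a b : is_derive x 1 f a -> a = b -> is_derive x 1 f b.
Proof. by move=> ? <-. Qed.

End PointwiseRules.

(** [cont] and [der] read off continuity and derivatives from the syntax of a
    function of a real variable. The explicit instances given to [refine] keep
    unification from exploring the topological structures on the line. *)
Ltac cont_step :=
  match goal with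
  | H : continuous ?f |- continuous ?f => exact H
  | |- continuous (fun x => x) => refine (@contid _)
  | |- continuous (fun x => ?c) => refine (@contc _ c)
  | |- continuous (fun x => @?f x + @?g x) => refine (@contD _ f g _ _)
  | |- continuous (fun x => - @?f x) => refine (@contN _ f _)
  | |- continuous (fun x => @?f x * @?g x) => refine (@contM _ f g _ _)
  | |- continuous (fun x => @?f x ^+ ?n) => refine (@contX _ f n _)
  | |- continuous (fun x => \sum_(i <- ?s) @?F x i) =>
      refine (@cont_sum _ _ s (fun i x => F x i) _); move=> ? /=
  | |- continuous expR => exact: expR_cont
  | |- continuous cos => exact: cos_cont
  | |- continuous sin => exact: sin_cont
  | |- continuous Num.sqrt => exact: sqrt_cont
  | |- continuous (fun x => ?g (@?f x)) => refine (@cont_comp _ f g _ _)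
  end.
Ltac cont := repeat cont_step.

Ltac der_step :=
  match goal with
  | H : forall x, is_derive x _ ?f _ |- is_derive _ _ ?f _ => exact: H
  | |- is_derive _ _ (fun x => x) _ => exact: derid
  | |- is_derive _ _ (fun x => ?c) _ => exact: derc
  | |- is_derive _ _ (fun x => @?f x + @?g x) _ => eapply (@derD _ f g)
  | |- is_derive _ _ (fun x => - @?f x) _ => eapply (@derN _ f)
  | |- is_derive _ _ (fun x => @?f x * @?g x) _ => eapply (@derM _ f g)
  | |- is_derive _ _ (fun x => @?f x ^+ ?n) _ => eapply (@derX _ f n)
  | |- is_derive _ _ (fun x => (@?f x)^-1) _ => eapply (@derV _ f)
  | |- is_derive _ _ expR _ => exact: is_derive_expR
  | |- is_derive _ _ cos _ => exact: is_derive_cos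
  | |- is_derive _ _ sin _ => exact: is_derive_sin
  | |- is_derive _ _ Num.sqrt _ => apply: is_derive1_sqrt
  | |- is_derive _ _ (fun x => ?g (@?f x)) _ => eapply (@der_comp _ g f)
  end.
Ltac der := eapply der_eq; [repeat der_step|].

(** * Integrals over segments *)

Section Segment.
Context {R : realType}.
Implicit Types (f g F : R -> R) (x a b c : R).
Notation mu := (@lebesgue_measure R).

Definition segint a b f : R := \int[mu]_(x in `[a, b]) f x.

Lemma cont_within f (A : set R) : continuous f -> {within A, continuous f}.
Proof. by move=> cf; apply: continuous_subspaceT. Qed.

Lemma seg_integrable a b f : continuous f ->
  mu.-integrable `[a, b] (EFin \o f).
Proof.
move=> cf; apply: continuous_compact_integrable; first exact: segment_compact.
exact: cont_within.
Qed.

Lemma segint_eq a b f g : (forall x, a <= x <= b -> f x = g x) ->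
  segint a b f = segint a b g.
Proof.
move=> fg; apply: eq_Rintegral => x; rewrite inE/= in_itv/= => xab; exact: fg.
Qed.

Lemma segintD a b f g : continuous f -> continuous g ->
  segint a b (fun x => f x + g x) = segint a b f + segint a b g.
Proof. by move=> cf cg; apply: RintegralD => //; exact: seg_integrable. Qed.

Lemma segintZ a b c f : continuous f ->
  segint a b (fun x => c * f x) = c * segint a b f.
Proof. by move=> cf; apply: RintegralZl => //; exact: seg_integrable. Qed.

Lemma segintN a b f : continuous f ->
  segint a b (fun x => - f x) = - segint a b f.
Proof.
by move=> cf; rewrite -[RHS]mulN1r -segintZ//; apply: segint_eq => x _; rewrite mulN1r.
Qed.

Lemma segintB a b f g : continuous f -> continuous g ->
  segint a b (fun x => f x - g x) = segint a b f - segint a b g.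
Proof. by move=> cf cg; apply: RintegralB => //; exact: seg_integrable. Qed.

Lemma segint_sum (I : Type) (s : seq I) (F : I -> R -> R) a b :
  (forall i, continuous (F i)) ->
  segint a b (fun x => \sum_(i <- s) F i x) = \sum_(i <- s) segint a b (F i).
Proof.
move=> cF; elim: s => [|i s IH].
  rewrite big_nil -[RHS](mul0r (segint a b (cst 0))) -segintZ; last exact: contc.
  by apply: segint_eq => x _; rewrite big_nil mul0r.
rewrite big_cons -IH -segintD//; last exact: cont_sum.
by apply: segint_eq => x _; rewrite big_cons.
Qed.

Lemma le_segint a b f g : continuous f -> continuous g ->
  (forall x, a <= x <= b -> f x <= g x) -> segint a b f <= segint a b g.
Proof.
move=> cf cg fg; apply: le_Rintegral => //.
- exact: (seg_integrable a b cf).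
- exact: (seg_integrable a b cg).
Qed.

Lemma segint_cst a b c : a <= b -> segint a b (fun=> c) = c * (b - a).
Proof.
move=> ab; rewrite /segint Rintegral_cst//= lebesgue_measure_itv/= lte_fin.
by case: ltgtP ab => [ab _||-> _]//=; rewrite subrr.
Qed.

Lemma normr_segint a b f g : continuous f -> continuous g ->
  (forall x, a <= x <= b -> `|f x| <= g x) -> `|segint a b f| <= segint a b g.
Proof.
move=> cf cg fg; rewrite ler_norml -segintN//; apply/andP; split; apply: le_segint => //.
- by cont.
- by move=> x /fg; rewrite ler_norml => /andP[].
- by move=> x /fg; rewrite ler_norml => /andP[].
Qed.

Lemma segint_point a f : segint a a f = 0.
Proof. by rewrite /segint set_itv1 Rintegral_set1. Qed.

Lemma segint_FTC a b f F : a <= b -> continuous f -> continuous F ->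
  (forall x, a < x < b -> is_derive x 1 F (f x)) -> segint a b f = F b - F a.
Proof.
rewrite le_eqVlt => /predU1P[<- *|ab cf cF dF]; first by rewrite segint_point subrr.
rewrite /segint /Rintegral (@continuous_FTC2 _ _ F)//.
- exact: cont_within.
- split.
  + by move=> x; rewrite in_itv/= => /dF[].
  + exact/cvg_at_right_filter/cF.
  + exact/cvg_at_left_filter/cF.
- by move=> x; rewrite in_itv/= => /dF[_ <-]; rewrite derive1E.
Qed.

Lemma segint_cat a b c f : continuous f -> a <= b -> b <= c ->
  segint a c f = segint a b f + segint b c f.
Proof.
move=> cf ab bc; have H := @Rintegral_itvB R f (BLeft a) (BRight c) b.
rewrite /segint; apply/eqP; rewrite addrC -subr_eq; apply/eqP.
rewrite H ?bnd_simp//; last exact: seg_integrable.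
apply: Rintegral_itv_obnd_cbnd; apply: integrableS (seg_integrable b c cf) => //.
exact: subset_itv_oc_cc.
Qed.

(** Every continuous function has a primitive on the whole line; translations,
    dilations and subdivisions of integrals are then computations on
    primitives. *)
Lemma primitive f : continuous f ->
  exists F : R -> R, forall x, is_derive x 1 F (f x).
Proof.
move=> cf.
exists (fun x => if 0 <= x then segint 0 x f else - segint x 0 f) => x.
have M0 : - (`|x| + 1) < 0 by rewrite oppr_lt0 ltr_pwDr.
have xN : x < `|x| + 1 by rewrite ltr_pwDr// ler_norm.
have Nx : - (`|x| + 1) < x.
  by rewrite ltrNl ltr_pwDr//; have := ler_norm (- x); rewrite normrN.
have ci := seg_integrable (- (`|x| + 1)) (`|x| + 1) cf.
have [dG G'] := continuous_FTC1_closed xN ci Nx (cf x).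
pose G y := segint (- (`|x| + 1)) y f.
have dG1 : is_derive x 1 (fun y => G y - G 0) (f x).
  apply: (@der_eq _ _ _ (f x + - 0)); last by rewrite oppr0 addr0.
  have dG0 : is_derive x 1 G (f x).
    by apply: DeriveDef; [exact: dG|rewrite -derive1E G'].
  exact: (derD dG0 (derN (derc (G 0) x))).
apply: near_eq_is_derive dG1; near=> y.
have Ny : - (`|x| + 1) < y by near: y; exact: lt_nbhsr.
case: ifPn => [y0|]; rewrite /G.
  by rewrite (@segint_cat (- (`|x| + 1)) 0 y f cf)// ?(ltW M0)// addrAC subrr add0r.
rewrite -ltNge => y0.
by rewrite (@segint_cat (- (`|x| + 1)) y 0 f cf)// ?(ltW y0) ?(ltW Ny)//; ring.
Unshelve. all: by end_near. Qed.

Lemma segint_shift a b s f : a <= b -> continuous f ->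
  segint a b (fun x => f (x + s)) = segint (a + s) (b + s) f.
Proof.
move=> ab cf; have [F dF] := primitive cf.
rewrite (@segint_FTC _ _ f F)// ?lerD2r//; last exact: (der_cont dF).
apply: (@segint_FTC _ _ _ (fun x => F (x + s))) => //.
- by cont.
- by cont; exact: (der_cont dF).
- by move=> x _; der; rewrite addr0 mulr1.
Qed.

Lemma segint_scale a b s f : a <= b -> 0 < s -> continuous f ->
  segint (s * a) (s * b) f = s * segint a b (fun x => f (s * x)).
Proof.
move=> ab s0 cf; have [F dF] := primitive cf.
rewrite (@segint_FTC _ _ f F)// ?ler_pM2l//; last exact: (der_cont dF).
rewrite -segintZ; last by cont.
apply/esym/(@segint_FTC _ _ _ (fun x => F (s * x))) => //; first by cont.
- by cont; exact: (der_cont dF).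
- by move=> x _; der; rewrite mulr0 addr0 mulr1 mulrC.
Qed.

Lemma segint_opp a f : 0 <= a -> continuous f ->
  segint (- a) a (fun x => f (- x)) = segint (- a) a f.
Proof.
move=> a0 cf; have [F dF] := primitive cf.
have aa : - a <= a by lra.
rewrite [RHS](@segint_FTC _ _ f F)//; last exact: (der_cont dF).
have -> : F a - F (- a) = - F (- a) - - F (- - a) by rewrite !opprK addrC.
apply: (@segint_FTC _ _ _ (fun x => - F (- x))) => //.
- by cont.
- by cont; exact: (der_cont dF).
- by move=> x _; der; rewrite mulrN1 opprK.
Qed.

Lemma segint_odd a f : 0 <= a -> continuous f -> (forall x, f (- x) = - f x) ->
  segint (- a) a f = 0.
Proof.
move=> a0 cf fN; have := segint_opp a0 cf.
under segint_eq do rewrite fN.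
by rewrite segintN// => /eqP; rewrite -subr_eq0 -opprD oppr_eq0 -mulr2n mulrn_eq0 => /eqP.
Qed.

End Segment.

(** * The entire function sinh (sqrt u) / sqrt u *)

Section EntireSeries.
Context {R : realType}.
Implicit Types (c : R^nat) (u x t : R).

Definition pseries_sum c u : R := limn (pseries c u).

(** A class of coefficients stable under formal derivation whose power series
    converge on the whole line. *)
Definition exp_dominated c := forall n, `|c n| <= (n`!%:R)^-1.

Lemma pseries_sum_cvg c u : exp_dominated c -> cvgn (pseries c u).
Proof.
move=> cd; apply: normed_cvg.
apply: (@series_le_cvg _ _ (exp_coeff `|u|)) => [n|n||].
- exact: normr_ge0.
- exact: exp_coeff_ge0.
- move=> n; rewrite /exp_coeff /= normrM normrX mulrC ler_wpM2l// exprn_ge0//.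
- exact: is_cvg_series_exp_coeff.
Qed.

Lemma exp_dominated_diffs c : exp_dominated c -> exp_dominated (pseries_diffs c).
Proof.
move=> cd n; rewrite /pseries_diffs normrM normr_nat.
apply: le_trans (ler_wpM2l _ (cd n.+1)) _ => //.
by rewrite factS natrM invfM mulrA divff ?mul1r// pnatr_eq0.
Qed.

Lemma der_pseries_sum c u : exp_dominated c ->
  is_derive u 1 (pseries_sum c) (pseries_sum (pseries_diffs c) u).
Proof.
move=> cd; apply: (@pseries_snd_diffs _ c (`|u| + 1)).
- exact: pseries_sum_cvg.
- exact/pseries_sum_cvg/exp_dominated_diffs.
- exact/pseries_sum_cvg/exp_dominated_diffs/exp_dominated_diffs.
- by rewrite (ger0_norm (_ : 0 <= `|u| + 1))// ?addr_ge0// ltrDl.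
Qed.

Lemma pseries_sum0 c : pseries_sum c 0 = c 0%N.
Proof.
apply/cvg_lim => //; rewrite -cvg_shiftS.
rewrite (_ : (fun n => _) = fun=> c 0%N); first exact: cvg_cst.
apply/funext => n; rewrite /pseries /series /= big_nat_recl//= expr0 mulr1.
by rewrite big1 ?addr0// => i _; rewrite expr0n mulr0.
Qed.

Lemma pseries_sum_ge_partial c u n : exp_dominated c -> (forall i, 0 <= c i) -> 0 <= u ->
  \sum_(0 <= i < n) c i * u ^+ i <= pseries_sum c u.
Proof.
move=> cd c0 u0.
have nd : nondecreasing_seq (pseries c u).
  by apply: nondecreasing_series => i _ _; rewrite mulr_ge0// exprn_ge0.
exact: (nondecreasing_cvgn_le nd (pseries_sum_cvg cd) n).
Qed.

Lemma le_pseries_sum c u x : exp_dominated c -> (forall i, 0 <= c i) -> 0 <= u <= x ->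
  pseries_sum c u <= pseries_sum c x.
Proof.
move=> cd c0 /andP[u0 ux]; apply: limr_le; first exact: pseries_sum_cvg.
near=> n; apply: le_trans (pseries_sum_ge_partial n cd c0 (le_trans u0 ux)).
apply: ler_sum => i _; rewrite ler_wpM2l// lerXn2r// ?nnegrE//.
exact: le_trans ux.
Unshelve. all: by end_near. Qed.

Definition sinhc_coeff (n : nat) : R := ((n.*2.+1)`!%:R)^-1.

Lemma sinhc_coeff_ge0 n : 0 <= sinhc_coeff n.
Proof. by rewrite invr_ge0. Qed.

Lemma sinhc_coeff_dom : exp_dominated sinhc_coeff.
Proof.
move=> n; rewrite ger0_norm ?sinhc_coeff_ge0// lef_pV2 ?posrE ?ltr0n ?fact_gt0//.
by rewrite ler_nat; apply: leq_fact; rewrite -addnn ltnW// ltnS leq_addr.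
Qed.

(** The entire function with [sinhc (t ^ 2) = sinh t / t]. *)
Definition sinhc := pseries_sum sinhc_coeff.
Definition sinhc' := pseries_sum (pseries_diffs sinhc_coeff).
Definition sinhc'' := pseries_sum (pseries_diffs (pseries_diffs sinhc_coeff)).

Lemma der_sinhc u : is_derive u 1 sinhc (sinhc' u).
Proof. exact: der_pseries_sum sinhc_coeff_dom. Qed.

Lemma der_sinhc' u : is_derive u 1 sinhc' (sinhc'' u).
Proof. exact/der_pseries_sum/exp_dominated_diffs/sinhc_coeff_dom. Qed.

Lemma sinhc_cont : continuous sinhc. Proof. exact: der_cont der_sinhc. Qed.

Lemma sinhc'_cont : continuous sinhc'. Proof. exact: der_cont der_sinhc'. Qed.

(** Comparing coefficients: [(4 n + 6) (n + 1) / (2 n + 3)! = 1 / (2 n + 1)!].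
    This equation is the analytic input behind the invariance of the window
    integral along parabolas. *)
Lemma sinhc_ode u : 4 * u * sinhc'' u + 6 * sinhc' u = sinhc u.
Proof.
set d := pseries_diffs sinhc_coeff.
have dd : exp_dominated d by exact/exp_dominated_diffs/sinhc_coeff_dom.
have c1 := pseries_sum_cvg (u := u) dd.
have c2 := pseries_diffs_equiv (pseries_sum_cvg (u := u) (exp_dominated_diffs dd)).
have H : (fun n => 4 * u * series (fun i => i%:R * d i * u ^+ i.-1) n
     + 6 * pseries d u n) @ \oo --> 4 * u * sinhc'' u + 6 * sinhc' u.
  by apply: cvgD; apply: cvgMl_tmp.
apply/esym/cvg_lim => //; rewrite (_ : pseries _ _ = fun n : nat =>
  4 * u * series (fun i => i%:R * d i * u ^+ i.-1) n + 6 * pseries d u n) //.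
apply/funext => n; rewrite /pseries /series /= !mulr_sumr -big_split/=.
apply: eq_bigr => i _.
have -> : sinhc_coeff i = (4 * i%:R + 6) * d i.
  rewrite /d /pseries_diffs /sinhc_coeff doubleS (factS i.*2.+2) (factS i.*2.+1) (natrM _ i.*2.+3) (natrM _ i.*2.+2).
  have H0 : (i.*2.+1`!)%:R != 0 :> R by rewrite pnatr_eq0 -lt0n fact_gt0.
  have -> : i.*2.+3%:R = 2 * i%:R + 3 :> R by rewrite -muln2 -addn3 natrD natrM; ring.
  have -> : i.*2.+2%:R = 2 * i%:R + 2 :> R by rewrite -muln2 -addn2 natrD natrM; ring.
  have i0 : 0 <= i%:R :> R by [].
  rewrite -natr1; move: H0; move: (i.*2.+1)`!%:R => Fq H0; field.
  by rewrite H0 !gt_eqF//; lra.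
by case: i => [|i]; rewrite ?expr0 /= ?exprS; ring.
Qed.

Lemma sinhc0 : sinhc 0 = 1.
Proof. by rewrite /sinhc pseries_sum0 /sinhc_coeff double0 factS fact0 muln1 invr1. Qed.

Definition cosh t : R := (expR t + expR (- t)) / 2.

(** [t * sinhc (t^2)] solves [h'' = h], [h 0 = 0], [h' 0 = 1]. *)
Lemma sinhc_sinh_cosh t :
  t * sinhc (t ^+ 2) = sinh t /\ sinhc (t ^+ 2) + 2 * t ^+ 2 * sinhc' (t ^+ 2) = cosh t.
Proof.
have dS := der_sinhc; have dS' := der_sinhc'.
pose h x := x * sinhc (x ^+ 2).
pose g x := sinhc (x ^+ 2) + 2 * x ^+ 2 * sinhc' (x ^+ 2).
have dh x : is_derive x 1 h (g x).
  by rewrite /h /g; der; rewrite expr1; ring.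
have dg x : is_derive x 1 g (h x).
  rewrite /h /g; der; rewrite -(sinhc_ode (x ^+ 2)) expr1; ring.
have H1 : expR (- t) * (h t + g t) = 1.
  pose F x := expR (- x) * (h x + g x).
  have -> : 1 = F 0 by rewrite /F oppr0 expR0 /h /g expr0n/= sinhc0; ring.
  apply: (@is_derive_0_is_cst _ F) => x; rewrite /F; der; ring.
have H2 : expR t * (g t - h t) = 1.
  pose F x := expR x * (g x - h x).
  have -> : 1 = F 0 by rewrite /F expR0 /h /g expr0n/= sinhc0; ring.
  apply: (@is_derive_0_is_cst _ F) => x; rewrite /F; der; ring.
have E : expR t * expR (- t) = 1 by rewrite -expRD subrr expR0.
have H3 : h t + g t = expR t.
  by rewrite -[LHS]mul1r -E -mulrA H1 mulr1.
have H4 : g t - h t = expR (- t).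
  by rewrite -[LHS]mul1r -E [expR t * _]mulrC -mulrA H2 mulr1.
by rewrite /sinh /cosh -H3 -H4 /h /g; split; field.
Qed.

Lemma le_sinhc u x : 0 <= u <= x -> sinhc u <= sinhc x.
Proof. exact: le_pseries_sum sinhc_coeff_dom sinhc_coeff_ge0. Qed.

Lemma bounded_on_segment (f : R -> R) (M : R) : continuous f ->
  exists B : R, 0 <= B /\ forall x : R, `|x| <= M -> `|f x| <= B.
Proof.
move=> cf; have [M0|M0] := leP 0 M; last first.
  by exists 0; split=> // x xM; have := le_trans (normr_ge0 x) xM; rewrite leNgt M0.
have cn : continuous (fun x => `|f x|).
  by move=> x; apply: (cvg_comp _ _ (cf x)); exact: norm_continuous.
have [|c _ cmax] := @EVT_max _ (fun x => `|f x|) (- M) M _ (cont_within cn).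
  by lra.
exists `|f c|; split=> // x; rewrite ler_norml => xM.
by apply: cmax; rewrite in_itv.
Qed.

End EntireSeries.

(** * The window integral *)

Section Kernel.
Context {R : realType}.
Implicit Types (x a b c q : R).

Definition halfcircle x : R := Num.sqrt (1 - x ^+ 2).

Lemma halfcircle_ge0 x : 0 <= halfcircle x.
Proof. exact: sqrtr_ge0. Qed.

Lemma halfcircle_cont : continuous halfcircle.
Proof. by rewrite /halfcircle; cont. Qed.

Lemma sqr_le1 x : -1 <= x <= 1 -> 0 <= 1 - x ^+ 2 <= 1.
Proof.
move=> /andP[x1 x2]; rewrite gerBl sqr_ge0 andbT subr_ge0 -ler_sqrt//.
by rewrite sqrtr1 sqrtr_sqr ler_norml x1.
Qed.

Lemma sqr_halfcircle x : -1 <= x <= 1 -> halfcircle x ^+ 2 = 1 - x ^+ 2.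
Proof. by move=> /sqr_le1/andP[? _]; rewrite sqr_sqrtr. Qed.

Lemma halfcircle_le1 x : halfcircle x <= 1.
Proof. by rewrite -[leRHS]sqrtr1 ler_wsqrtr// gerBl sqr_ge0. Qed.

Lemma halfcircle1 : halfcircle 1 = 0.
Proof. by rewrite /halfcircle expr1n subrr sqrtr0. Qed.

Lemma halfcircleN x : halfcircle (- x) = halfcircle x.
Proof. by rewrite /halfcircle sqrrN. Qed.

Lemma halfcircle_gt0 x : -1 < x < 1 -> 0 < halfcircle x.
Proof.
move=> /andP[x1 x2]; rewrite sqrtr_gt0.
have -> : 1 - x ^+ 2 = (1 - x) * (1 + x) by ring.
by rewrite mulr_gt0//; lra.
Qed.

Lemma der_halfcircle x : -1 < x < 1 ->
  is_derive x 1 halfcircle (- x / halfcircle x).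
Proof.
move=> x1; have h0 := halfcircle_gt0 x1; rewrite /halfcircle; der.
  by rewrite -sqrtr_gt0.
by rewrite -/(halfcircle x) expr1; field; rewrite gt_eqF.
Qed.

(** Up to the factor [beta / sinh beta], the Fourier transform of the sinh
    window with [b = beta ^ 2] at frequency [a / (2 pi)]. *)
Definition wint b a : R :=
  segint (-1) 1 (fun x => halfcircle x * sinhc (b * (1 - x ^+ 2)) * cos (a * x)).

Lemma wint_integrand_cont b a :
  continuous (fun x => halfcircle x * sinhc (b * (1 - x ^+ 2)) * cos (a * x)).
Proof. by have ch := halfcircle_cont; have cS := @sinhc_cont R; cont. Qed.

Let f c a x : R :=
  halfcircle x * sinhc ((c + a ^+ 2) * (1 - x ^+ 2)) * cos (a * x).

Let df c a x : R := halfcircle x *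
  (2 * a * (1 - x ^+ 2) * sinhc' ((c + a ^+ 2) * (1 - x ^+ 2)) * cos (a * x)
   - x * sinhc ((c + a ^+ 2) * (1 - x ^+ 2)) * sin (a * x)).

Let der_f c x a : is_derive a 1 (f c ^~ x) (df c a x).
Proof.
have dS := @der_sinhc R; rewrite /f; der.
by rewrite /df expr1; ring.
Qed.

(** By [sinhc_ode], the integrand is the derivative in [x] of
    [2 (1 - x^2)^(3/2) sinhc' ((c + a^2) (1 - x^2)) sin (a x)], which vanishes
    at both end points. *)
Lemma segint_dwint c a : segint (-1) 1 (df c a) = 0.
Proof.
have dS := @der_sinhc' R.
have cS := @sinhc_cont R; have cS1 := @sinhc'_cont R; have ch := halfcircle_cont.
pose F x := 2 * halfcircle x ^+ 3 * sinhc' ((c + a ^+ 2) * (1 - x ^+ 2)) * sin (a * x).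
have -> : 0 = F 1 - F (-1).
  by rewrite /F halfcircleN halfcircle1 expr0n/= !mulr0 !mul0r subrr.
apply: segint_FTC => //; [by rewrite /df; cont|by rewrite /F; cont|].
move=> x x1; have dh := der_halfcircle x1; have h0 := halfcircle_gt0 x1.
have h2 : 1 - x ^+ 2 = halfcircle x ^+ 2.
  by rewrite sqr_halfcircle//; move: x1 => /andP[x1 x2]; rewrite !ltW.
rewrite /F; eapply der_eq; [repeat (der_step || exact: dh)|].
rewrite /df -(sinhc_ode ((c + a ^+ 2) * (1 - x ^+ 2))) h2 /=.
by field; rewrite gt_eqF.
Qed.

Let df_bound c (A : R) : exists B : R, 0 <= B /\
  forall a x, `|a| <= A -> -1 <= x <= 1 -> `|df c a x| <= B.
Proof.
have [B0 [B0p HB0]] := bounded_on_segment (`|c| + A ^+ 2) (@sinhc_cont R).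
have [B1 [B1p HB1]] := bounded_on_segment (`|c| + A ^+ 2) (@sinhc'_cont R).
exists (`|2 * A * B1| + B0); split; first by rewrite addr_ge0.
move=> a x aA x1; have A0 : 0 <= A by exact: le_trans aA.
have /andP[u0 u1] := sqr_le1 x1.
have uM : `|(c + a ^+ 2) * (1 - x ^+ 2)| <= `|c| + A ^+ 2.
  rewrite normrM (ger0_norm u0); apply: le_trans (_ : `|c + a ^+ 2| <= _).
    by rewrite ler_piMr.
  apply: le_trans (ler_normD _ _) _; rewrite lerD2l normrX lerXn2r// nnegrE//.
have nx : `|x| <= 1 by rewrite ler_norml.
have ncos : `|cos (a * x)| <= 1 by rewrite ler_norml cos_geN1 cos_le1.
have nsin : `|sin (a * x)| <= 1 by rewrite ler_norml sin_geN1 sin_le1.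
have mul1 (y z : R) : `|y| <= 1 -> `|y * z| <= `|z|.
  by move=> y1; rewrite normrM ler_piMl.
have nh : `|halfcircle x| <= 1 by rewrite ger0_norm ?halfcircle_ge0 ?halfcircle_le1.
rewrite /df; apply: le_trans (mul1 _ _ nh) _.
apply: le_trans (ler_normB _ _) _; apply: lerD.
  rewrite mulrC; apply: le_trans (mul1 _ _ ncos) _.
  rewrite [2 * a * _ * _]mulrAC mulrC; apply: le_trans (mul1 _ _ _) _.
    by rewrite ger0_norm.
  rewrite -!mulrA !normrM ler_wpM2l//; apply: ler_pM => //.
    by rewrite (ger0_norm A0).
  by rewrite (ger0_norm B1p) HB1.
rewrite mulrC; apply: le_trans (mul1 _ _ nsin) _.
by apply: le_trans (mul1 _ _ nx) _; exact: HB0.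
Qed.

Let is_derive_wint c a : is_derive a 1 (fun a => wint (c + a ^+ 2) a) 0.
Proof.
(* Any neighbourhood of [a] would do; this one is symmetric, hence [|a'| <= A]. *)
pose A : R := `|a| + 1; have [B [B0 HB]] := df_bound c A.
have cS := @sinhc_cont R; have cS1 := @sinhc'_cont R; have ch := halfcircle_cont.
have Ia : [set` `]- A, A[] a.
  by rewrite /= in_itv/= -ltr_norml ltrDl.
have AE a' : [set` `]- A, A[] a' -> `|a'| <= A.
  by rewrite /= in_itv/= -ltr_norml => /ltW.
have intf a' : [set` `]- A, A[] a' ->
    (@lebesgue_measure R).-integrable `[-1, 1] (EFin \o f c a').
  by move=> _; apply: seg_integrable; exact: wint_integrand_cont.
have derf a' x : [set` `]- A, A[] a' -> [set` `[-1, 1]%R] x -> derivable (f c ^~ x) a' 1.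
  by move=> _ _; have [] := der_f c x a'.
have pE a' x : partial1of2 (f c) a' x = df c a' x.
  by rewrite partial1of2E; have [_ ->] := der_f c x a'.
have intG : (@lebesgue_measure R).-integrable `[-1, 1] (EFin \o (fun _ : R => B)).
  by apply: seg_integrable; cont.
have Gub a' x : [set` `]- A, A[] a' -> [set` `[-1, 1]%R] x ->
    `|partial1of2 (f c) a' x| <= B.
  by move=> /AE aA; rewrite /= in_itv/= pE => x1; exact: HB.
have der := @derivable_under_integral R _ _ (@lebesgue_measure R) (f c) _ (measurable_itv `[-1, 1]) _ _ _ Ia intf derf _ (fun=> B0) intG Gub.
have derE := @differentiation_under_integral R _ _ (@lebesgue_measure R) (f c) _ (measurable_itv `[-1, 1]) _ _ _ Ia intf derf _ (fun=> B0) intG Gub.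
apply: DeriveDef; first exact: der.
rewrite -derive1E [LHS]derE -(segint_dwint c a).
by apply: segint_eq => x _; exact: pE.
Qed.

(** Differentiate along the parabola [b = c + a ^ 2] under the integral sign.
    Up to a factor [pi], the common value is [I_1 (sqrt c) / sqrt c] for
    positive [c] and [J_1 (sqrt (- c)) / sqrt (- c)] for negative [c]; this is
    the classical Fourier transform of the window, obtained without Bessel
    functions. *)
Lemma wintE c a : wint (c + a ^+ 2) a = wint c 0.
Proof.
have := @is_derive_0_is_cst _ (fun a => wint (c + a ^+ 2) a) a 0 (is_derive_wint c).
by rewrite /= expr0n addr0.
Qed.

End Kernel.

(** * Exponential growth of the window integral *)

Section Mean.
Context {R : realType}.
Implicit Types (f : R -> R) (x a b : R).

Lemma der_ge0_le f (f' : R -> R) a b : a <= b ->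
  (forall x, a <= x <= b -> is_derive x 1 f (f' x)) ->
  (forall x, a <= x <= b -> 0 <= f' x) -> f a <= f b.
Proof.
move=> ab df f0.
have [||c] := @MVT_segment _ f f' a b ab.
- move=> x; rewrite in_itv/= => /andP[ax xb]; apply: df; by rewrite !ltW.
- apply: derivable_within_continuous => x; rewrite in_itv/= => xab.
  by have [] := df x xab.
- rewrite in_itv/= => cab E; rewrite -subr_ge0 E mulr_ge0 ?subr_ge0//; exact: f0.
Qed.

Lemma der_le f g (f' g' : R -> R) a b : a <= b ->
  (forall x, a <= x <= b -> is_derive x 1 f (f' x)) ->
  (forall x, a <= x <= b -> is_derive x 1 g (g' x)) ->
  (forall x, a <= x <= b -> f' x <= g' x) -> f b - f a <= g b - g a.
Proof.
move=> ab df dg fg.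
have H x : a <= x <= b -> is_derive x 1 (fun x => g x - f x) (g' x - f' x).
  by move=> xab; apply: derD; [exact: dg|apply: derN; exact: df].
have H2 x : a <= x <= b -> 0 <= g' x - f' x by move=> /fg; rewrite subr_ge0.
by have := der_ge0_le ab H H2; lra.
Qed.

End Mean.

Section Moments.
Context {R : realType}.
Implicit Types (x s t z : R) (n : nat).

(** Up to a factor depending on [n] only, the coefficient of [q ^ n] in
    [wint q 0]. *)
Definition moment n : R :=
  segint (-1) 1 (fun x => halfcircle x * (1 - x ^+ 2) ^+ n).

(** Substitute [x = sin t]. *)
Lemma moment0 : moment 0 = pi / 2.
Proof.
have ch := @halfcircle_cont R.
have [F dF] := primitive ch.
have -> : moment 0 = F 1 - F (-1).
  rewrite /moment (_ : segint _ _ _ = segint (-1) 1 halfcircle); last first.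
    by apply: segint_eq => x _; rewrite expr0 mulr1.
  by apply: segint_FTC => //; exact: der_cont dF.
have pi0 := pi_gt0 R.
pose G t := F (sin t); pose H t : R := (t + sin t * cos t) / 2.
have dG t : - (pi / 2) <= t <= pi / 2 -> is_derive t 1 G (cos t ^+ 2).
  move=> tp; rewrite /G; der; rewrite /halfcircle -cos2sin2 sqrtr_sqr.
  have c0 : 0 <= cos t by exact: cos_ge0_pihalf.
  by rewrite ger0_norm// mulr1 expr2.
have dH t : - (pi / 2) <= t <= pi / 2 -> is_derive t 1 H (cos t ^+ 2).
  move=> _; rewrite /H; der.
  by have := cos2Dsin2 t; lra.
have pp : - (pi / 2) <= pi / 2 :> R by lra.
have := der_le pp dG dH (fun x _ => lexx _); have := der_le pp dH dG (fun x _ => lexx _).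
rewrite /G /H sinN sin_pihalf cosN cos_pihalf => h1 h2.
by apply/eqP; rewrite eq_le; lra.
Qed.

(** Integrate the derivative of [x (1 - x ^ 2) ^ (n + 3 / 2)]. *)
Lemma momentS n : (2 * n%:R + 4) * moment n.+1 = (2 * n%:R + 3) * moment n.
Proof.
have ch := @halfcircle_cont R.
pose u x : R := 1 - x ^+ 2.
pose F x := x * halfcircle x * u x ^+ n.+1.
apply/eqP; rewrite -subr_eq0 -!segintZ; [|by cont|by cont].
rewrite -segintB; [|by cont|by cont].
have -> : 0 = F 1 - F (-1).
  by rewrite /F halfcircleN halfcircle1 !mulr0 !mul0r subrr.
apply/eqP; apply: segint_FTC => //; [by cont|by rewrite /F /u; cont|].
move=> x x1; have dh := der_halfcircle x1; have h0 := halfcircle_gt0 x1.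
have h2 : u x = halfcircle x ^+ 2.
  by rewrite sqr_halfcircle//; move: x1 => /andP[x1 x2]; rewrite !ltW.
have x2 : x ^+ 2 = 1 - halfcircle x ^+ 2 by rewrite -h2 /u; ring.
rewrite /F; eapply der_eq; [rewrite /u; repeat (der_step || exact: dh)|].
rewrite -/(u x) h2 -natr1 /= !(exprS (_ ^+ 2)).
move: (halfcircle x) h0 x2 ((halfcircle x ^+ 2) ^+ n) => h h0 x2 y.
transitivity ((2 * n%:R + 4) * (h * (h ^+ 2 * y)) - (2 * n%:R + 3) * (h * y)
  - (h * y + 2 * (n%:R + 1) * h * y) * (x ^+ 2 - (1 - h ^+ 2))).
  by field; rewrite gt_eqF.
by rewrite x2 subrr mulr0 subr0.
Qed.

Lemma moment_gt0 n : 0 < moment n.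
Proof.
elim: n => [|n IH]; first by rewrite moment0 divr_gt0// pi_gt0.
have n0 : 0 <= n%:R :> R by [].
have c0 : 0 < 2 * n%:R + 4 :> R by lra.
by rewrite -(pmulr_rgt0 _ c0) momentS mulr_gt0//; lra.
Qed.

(** The sequence [(4 n + 5) (moment n)^2] increases (to [4 pi], by Wallis);
    its first term is within two percent of the limit. *)
Lemma moment_sqr_ge n : 5 * (pi / 2) ^+ 2 <= (4 * n%:R + 5) * moment n ^+ 2.
Proof.
elim: n => [|n IH]; first by rewrite moment0 mulr0 add0r.
apply: le_trans IH _; have n0 : 0 <= n%:R :> R by [].
have c0 : 0 < (2 * n%:R + 4) ^+ 2 :> R by rewrite exprn_gt0//; lra.
rewrite -(ler_pM2l c0) mulrCA [leRHS]mulrCA -[X in _ <= _ * X]exprMn momentS exprMn.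
move: (moment n ^+ 2) (sqr_ge0 (moment n)) => M M0; rewrite !mulrA ler_wpM2r//.
rewrite -natr1.
rewrite -subr_ge0 (_ : _ - _ = 1) ?ler01//; ring.
Qed.

(** The convex function [y |-> y^(-1/2)], taken at [y = 4 n + 5], lies above its
    tangent line at [t]. A bound that is affine in [n] can be summed against
    the coefficients of [sinhc]. *)
Lemma moment_ge_tangent t n : 0 < t ->
  Num.sqrt 5 * (pi / 2) / Num.sqrt t * (3 / 2 - (4 * n%:R + 5) / (2 * t)) <= moment n.
Proof.
move=> t0; have n0 : 0 <= n%:R :> R by [].
set y : R := 4 * n%:R + 5; have y0 : 0 < y by rewrite /y; lra.
have pi0 := pi_gt0 R.
have p0 : 0 < Num.sqrt y by rewrite sqrtr_gt0.
have q0 : 0 < Num.sqrt t by rewrite sqrtr_gt0.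
have W0 := moment_gt0 n.
set C := Num.sqrt 5 * (pi / 2).
have C0 : 0 < C by rewrite mulr_gt0 ?sqrtr_gt0//; lra.
have H : C <= Num.sqrt y * moment n.
  have C0' := ltW C0; have p0' := ltW p0; have W0' := ltW W0.
  rewrite -(ler_pXn2r (n := 2))// ?nnegrE ?mulr_ge0//.
  rewrite /C (exprMn _ (Num.sqrt 5)) (exprMn _ (Num.sqrt y)) !sqr_sqrtr ?(ltW y0)//; exact: moment_sqr_ge.
have [h|h] := leP (3 / 2 - y / (2 * t)) 0.
  by apply: le_trans (ltW W0); rewrite mulr_ge0_le0// divr_ge0// ltW.
have ty : t = Num.sqrt t ^+ 2 by rewrite sqr_sqrtr// ltW.
have yy : y = Num.sqrt y ^+ 2 by rewrite sqr_sqrtr// ltW.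
apply: le_trans (_ : Num.sqrt y * moment n / Num.sqrt t * (3 / 2 - y / (2 * t)) <= _).
  apply: ler_wpM2r; first exact: ltW.
  by apply: ler_wpM2r H; rewrite invr_ge0 ltW.
rewrite [X in y / (2 * X)]ty [X in X / (2 * _)]yy.
move: (Num.sqrt y) (Num.sqrt t) p0 q0 (moment n) W0 => p q p0 q0 w w0.
rewrite -subr_ge0 (_ : _ - _ = w * ((p - q) ^+ 2 * (p + 2 * q)) / (2 * q ^+ 3)).
  have p0' := ltW p0; have q0' := ltW q0; have w0' := ltW w0.
  apply: divr_ge0; last by apply: mulr_ge0 => //; exact: exprn_ge0.
  apply: mulr_ge0 => //; apply: mulr_ge0; [exact: sqr_ge0|by lra].
by field; rewrite gt_eqF.
Qed.

Lemma wint_le (q q' : R) : 0 <= q <= q' -> wint q 0 <= wint q' 0.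
Proof.
move=> /andP[q0 qq]; apply: le_segint; [exact: wint_integrand_cont..|].
move=> x x1; rewrite !mul0r cos0 !mulr1 ler_wpM2l ?halfcircle_ge0//.
have /andP[u0 u1] := sqr_le1 x1.
by rewrite le_sinhc// mulr_ge0//= ler_wpM2r.
Qed.

(** Truncate the series of [sinhc], integrate term by term, and let the
    truncation order grow; an affine bound on the moments turns the sum into
    [sinhc] and its derivative. *)
Lemma wint0_ge (q a b : R) : 0 <= q ->
  (forall n, a - b * n%:R <= moment n) ->
  a * sinhc q - b * (q * sinhc' q) <= wint q 0.
Proof.
move=> q0 Hw.
set c := @sinhc_coeff R; have cd := @sinhc_coeff_dom R.
have c2 := pseries_diffs_equiv (pseries_sum_cvg (u := q) (exp_dominated_diffs cd)).
have H : (fun n => a * pseries c q n -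
    b * (q * series (fun i => i%:R * c i * q ^+ i.-1) n)) @ \oo
    --> a * sinhc q - b * (q * sinhc' q).
  apply: cvgB; first by apply: cvgMl_tmp; exact: (pseries_sum_cvg cd).
  by apply: cvgMl_tmp; apply: cvgMl_tmp; exact: c2.
apply: (cvgr_to_le H); near=> N.
have ch := @halfcircle_cont R.
apply: le_trans (_ : \sum_(0 <= i < N) c i * q ^+ i * moment i <= _).
  rewrite /pseries /series /= !mulr_sumr -sumrB; apply: ler_sum => i _.
  apply: le_trans (_ : c i * q ^+ i * (a - b * i%:R) <= _).
    rewrite le_eqVlt; apply/orP; left; apply/eqP.
    by case: i => [|i]; rewrite /= ?exprS; ring.
  by rewrite ler_wpM2l// mulr_ge0 ?exprn_ge0// sinhc_coeff_ge0.
have -> : \sum_(0 <= i < N) c i * q ^+ i * moment i = segint (-1) 1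
    (fun x => \sum_(0 <= i < N) c i * q ^+ i * (halfcircle x * (1 - x ^+ 2) ^+ i)).
  rewrite segint_sum; last by move=> i; cont.
  by apply: eq_bigr => i _; rewrite segintZ//; cont.
apply: le_segint; [by cont|exact: wint_integrand_cont|] => x x1.
have /andP[u0 u1] := sqr_le1 x1.
rewrite mul0r cos0 mulr1.
rewrite (eq_bigr (fun i => halfcircle x * (c i * (q * (1 - x ^+ 2)) ^+ i))); last first.
  by move=> i _; rewrite exprMn; ring.
rewrite -mulr_sumr ler_wpM2l ?halfcircle_ge0//.
by apply: (pseries_sum_ge_partial N cd (@sinhc_coeff_ge0 R)); rewrite mulr_ge0.
Unshelve. all: by end_near. Qed.

(** The coefficients [s^(2n+1) / (2n+1)!] of [sinh s] concentrate around
    [2 n + 1 = s], where [4 n + 5 = 2 s + 3]: this is the point [t] at which the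
    tangent is taken. The loss against the true asymptotics is a factor
    tending to about [1.02]. *)
Lemma wint0_ge_exp s : 0 < s ->
  Num.sqrt 5 * (pi / 2) / Num.sqrt (2 * s + 3) * (expR s / 2 - expR (- s)) <=
  s * wint (s ^+ 2) 0.
Proof.
move=> s0; set t := 2 * s + 3; have t0 : 0 < t by rewrite /t; lra.
set C := Num.sqrt 5 * (pi / 2) / Num.sqrt t.
have pi0 := pi_gt0 R.
have C0 : 0 <= C by rewrite divr_ge0 ?sqrtr_ge0// mulr_ge0 ?sqrtr_ge0//; lra.
have H n : C * (3 / 2 - 5 / (2 * t)) - C * (2 / t) * n%:R <= moment n.
  apply: le_trans (moment_ge_tangent n t0); rewrite -/C.
  by rewrite le_eqVlt; apply/orP; left; apply/eqP; field; rewrite gt_eqF.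
have := wint0_ge (sqr_ge0 s) H; rewrite -(ler_pM2l s0); apply: le_trans.
have [hs hc] := sinhc_sinh_cosh s.
set S := sinhc (s ^+ 2) in hs hc *; set S' := sinhc' (s ^+ 2) in hc *.
have -> : s * (C * (3 / 2 - 5 / (2 * t)) * S - C * (2 / t) * (s ^+ 2 * S'))
  = C * ((s * S) * (3 / 2 - 5 / (2 * t) + 1 / t) - s * (S + 2 * s ^+ 2 * S') / t).
  by field; rewrite gt_eqF.
rewrite hs hc ler_wpM2l// /sinh /cosh.
rewrite -subr_ge0 (_ : _ - _ = expR (- s) * (3 / (2 * t))).
  by rewrite mulr_ge0 ?expR_ge0// divr_ge0//; lra.
rewrite /t; field; rewrite gt_eqF//; lra.
Qed.

End Moments.

(** * Oscillatory decay of the window integral, bounds on pi *)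

Section Oscillation.
Context {R : realType}.
Implicit Types (x a b z q : R).

(** On the parabola through [b = 0] the factor [sinhc] is constant. *)
Lemma wint_neg z : wint (- z ^+ 2) 0 =
  segint (-1) 1 (fun x => halfcircle x * cos (z * x)).
Proof.
rewrite -(wintE _ z) addNr; apply: segint_eq => x _.
by rewrite mul0r sinhc0 mulr1.
Qed.

Lemma normr_wint_neg z : `|wint (- z ^+ 2) 0| <= pi / 2.
Proof.
have ch := @halfcircle_cont R.
rewrite wint_neg -moment0; apply: normr_segint; [by cont|by cont|].
move=> x _; rewrite expr0 mulr1 normrM ger0_norm ?halfcircle_ge0//.
by rewrite ler_piMr ?halfcircle_ge0// ler_norml cos_geN1 cos_le1.
Qed.

(** Two integrations by parts on [[-c, c]], [c^2 = 1 - 1/z], where the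
    derivative of the half circle stays below [sqrt z]; the remaining caps are
    estimated trivially. *)
Lemma normr_wint_neg_decay q : 1 <= q ->
  `|wint (- (q ^+ 2) ^+ 2) 0| <= 8 / q ^+ 3.
Proof.
move=> q1; have q0 : 0 < q by lra.
have qn0 : q != 0 by rewrite gt_eqF.
set z := q ^+ 2; have z0 : 0 < z by rewrite exprn_gt0.
have z1 : 1 <= z by rewrite exprn_ege1.
have iz : 0 < z^-1 <= 1 by rewrite invr_gt0 z0 invf_le1.
pose c := Num.sqrt (1 - z^-1).
have c2 : c ^+ 2 = 1 - z^-1 by rewrite sqr_sqrtr//; lra.
have c0 : 0 <= c by exact: sqrtr_ge0.
have c1 : c < 1.
  by rewrite -(ltr_pXn2r (n := 2))// ?nnegrE// c2 expr1n; lra.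
have hc : halfcircle c = q^-1.
  rewrite /halfcircle c2 opprB addrCA subrr addr0 /z -exprVn sqrtr_sqr.
  by rewrite ger0_norm// invr_ge0 ltW.
have cc : 1 - c <= z^-1.
  have : c ^+ 2 <= c by rewrite expr2 ler_piMl// ltW.
  by rewrite c2; lra.
have ch := @halfcircle_cont R.
pose f x := halfcircle x * cos (z * x).
have cf : continuous f by rewrite /f; cont.
have cap x : c ^+ 2 <= x ^+ 2 -> `|f x| <= q^-1.
  move=> cx; rewrite /f normrM ger0_norm ?halfcircle_ge0//.
  apply: le_trans (_ : halfcircle x <= _).
    by rewrite ler_piMr ?halfcircle_ge0// ler_norml cos_geN1 cos_le1.
  by rewrite -hc /halfcircle ler_wsqrtr// lerD2l lerN2.
have capint a b : a <= b -> b - a <= z^-1 ->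
    (forall x, a <= x <= b -> c ^+ 2 <= x ^+ 2) ->
    `|segint a b f| <= (q ^+ 3)^-1.
  move=> ab abz H; apply: le_trans (_ : q^-1 * (b - a) <= _).
    rewrite -segint_cst//; apply: normr_segint => //; first by cont.
    by move=> x xab; apply/cap/H.
  rewrite (_ : (q ^+ 3)^-1 = q^-1 * z^-1); last by rewrite /z; field.
  by rewrite ler_wpM2l// invr_ge0 ltW.
have mid : `|segint (- c) c f| <= 6 / q ^+ 3.
  have ncc : - c <= c by lra.
  have [F dF] := primitive cf.
  rewrite (@segint_FTC _ _ _ f F)//; last by exact: der_cont dF.
  (* [D' = f - E' cos], and [E'] is nonnegative: [F - D] grows at most as fast
     as [E]. *)
  pose D x := halfcircle x * sin (z * x) / z - x / halfcircle x * cos (z * x) / z ^+ 2.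
  pose E x := x / halfcircle x / z ^+ 2.
  pose E' x := (halfcircle x ^+ 3)^-1 / z ^+ 2.
  have xin x : - c <= x <= c -> -1 < x < 1 by move=> /andP[? ?]; apply/andP; split; lra.
  have dE x : - c <= x <= c -> is_derive x 1 E (E' x).
    move=> /xin x1; have dh := der_halfcircle x1; have h0 := halfcircle_gt0 x1.
    have h2 : x ^+ 2 = 1 - halfcircle x ^+ 2.
      by rewrite sqr_halfcircle ?subKr//; move: x1 => /andP[x1 x2]; rewrite !ltW.
    rewrite /E; eapply der_eq; [repeat (der_step || exact: dh); rewrite gt_eqF//|].
    rewrite /E'; move: (halfcircle x) h0 h2 => h h0 h2.
    transitivity ((x ^+ 2 + h ^+ 2) / h ^+ 3 / z ^+ 2).
      by field; rewrite !gt_eqF.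
    by rewrite h2; field; rewrite !gt_eqF.
  have dD x : - c <= x <= c -> is_derive x 1 D (f x - E' x * cos (z * x)).
    move=> xc; have x1 := xin _ xc.
    have dh := der_halfcircle x1; have h0 := halfcircle_gt0 x1.
    have dDE : is_derive x 1
        (fun x => halfcircle x * sin (z * x) / z - E x * cos (z * x))
        (f x - E' x * cos (z * x)).
      have dEx := dE x xc.
      eapply der_eq; [repeat (der_step || exact: dh || exact: dEx)|].
      rewrite /f /E; field; rewrite !gt_eqF//.
    by move: dDE; rewrite (_ : (fun _ => _) = D)//; apply/funext => y; rewrite /D /E; ring.
  have E'0 x : - c <= x <= c -> 0 <= E' x.
    by move=> _; rewrite /E' divr_ge0 ?invr_ge0 ?exprn_ge0 ?halfcircle_ge0// ltW.
  have nc x : -1 <= cos (z * x) <= 1 by rewrite cos_geN1 cos_le1.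
  have up : F c - F (- c) <= (D c + E c) - (D (- c) + E (- c)).
    apply: (@der_le _ F (fun x => D x + E x) f
       (fun x => (f x - E' x * cos (z * x)) + E' x)) => //.
    - by move=> x xc; apply: derD; [exact: dD|exact: dE].
    - move=> x xc; have /andP[_ h] := nc x.
      have := ler_wpM2l (E'0 x xc) h; lra.
  have lo : (D c - E c) - (D (- c) - E (- c)) <= F c - F (- c).
    apply: (@der_le _ (fun x => D x - E x) F
       (fun x => (f x - E' x * cos (z * x)) - E' x) f) => //.
    - by move=> x xc; apply: derD; [exact: dD|apply: derN; exact: dE].
    - move=> x xc; have /andP[h _] := nc x.
      have := ler_wpM2l (E'0 x xc) h; lra.
  have EN : E (- c) = - E c by rewrite /E halfcircleN !mulNr.
  have DN : D (- c) = - D c.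
    by rewrite /D halfcircleN mulrN sinN cosN; ring.
  move: up lo; rewrite EN DN => up lo.
  have Ec : 0 <= E c <= (q ^+ 3)^-1.
    rewrite /E hc invrK /z (_ : c * q / _ = c / q ^+ 3); last by field.
    by rewrite divr_ge0 ?exprn_ge0 ?(ltW q0)//= ler_pdivrMr ?exprn_gt0// mulVf ?expf_neq0// ltW.
  have Dc : `|D c| <= 2 / q ^+ 3.
    rewrite /D hc invrK; apply: le_trans (ler_normB _ _) _.
    have -> : q^-1 * sin (z * c) / z = sin (z * c) / q ^+ 3 by rewrite /z; field.
    have -> : c * q * cos (z * c) / z ^+ 2 = c * cos (z * c) / q ^+ 3 by rewrite /z; field.
    have q3 : 0 <= (q ^+ 3)^-1 by rewrite invr_ge0 exprn_ge0// ltW.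
    rewrite !(normrM _ (q ^+ 3)^-1) -mulrDl (ger0_norm q3) ler_wpM2r//.
    have s1 : `|sin (z * c)| <= 1 by rewrite ler_norml sin_geN1 sin_le1.
    have k1 : `|c * cos (z * c)| <= 1.
      rewrite normrM (ger0_norm c0) mulr_ile1//; first exact: ltW.
      by rewrite ler_norml.
    by lra.
  move: Dc; rewrite !ler_norml.
  by move: (q ^+ 3)^-1 Ec => Q Ec Dc; lra.
rewrite wint_neg -/f.
rewrite (@segint_cat _ (-1) (- c) 1)//; [|by lra|by lra].
rewrite (@segint_cat _ (- c) c 1)//; [|by lra|by lra].
have c3 : `|segint c 1 f| <= (q ^+ 3)^-1.
  apply: capint; [lra|lra|move=> x /andP[cx _]].
  by rewrite lerXn2r// nnegrE//; exact: le_trans cx.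
have c4 : `|segint (-1) (- c) f| <= (q ^+ 3)^-1.
  apply: capint; [lra|lra|move=> x /andP[_ cx]].
  by rewrite -(sqrrN x) lerXn2r// ?nnegrE; lra.
move: mid c3 c4; rewrite !ler_norml; move: (q ^+ 3)^-1 => Q; lra.
Qed.

Let polyint (k2 k4 k6 : R) :
  segint (-1) 1 (fun x => 1 - k2 * x ^+ 2 - k4 * x ^+ 4 - k6 * x ^+ 6)
  = 2 - 2 * k2 / 3 - 2 * k4 / 5 - 2 * k6 / 7.
Proof.
pose F x := x - k2 * x ^+ 3 / 3 - k4 * x ^+ 5 / 5 - k6 * x ^+ 7 / 7.
transitivity (F 1 - F (-1)); last by rewrite /F; field.
apply: segint_FTC => //; [by cont|by rewrite /F; cont|].
by move=> x _; rewrite /F; der; rewrite /=; field.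
Qed.

(** Numerical bounds on [pi], from polynomial bounds on the half circle. *)
Lemma pi_bounds : 3 <= (pi : R) <= 16 / 5.
Proof.
have ch := @halfcircle_cont R.
have E : moment 0 = segint (-1) 1 halfcircle :> R.
  by apply: segint_eq => x _; rewrite expr0 mulr1.
have lo : segint (-1) 1 (fun x => 1 - 1 / 2 * x ^+ 2 - 1 / 8 * x ^+ 4 - 3 / 8 * x ^+ 6)
    <= segint (-1) 1 halfcircle.
  apply: le_segint => //; first by cont.
  move=> x x1; have h2 := sqr_halfcircle x1; have /andP[u0 u1] := sqr_le1 x1.
  apply: (@le_trans _ _ `|1 - 1 / 2 * x ^+ 2 - 1 / 8 * x ^+ 4 - 3 / 8 * x ^+ 6|).
    exact: ler_norm.
  rewrite -sqrtr_sqr ler_wsqrtr//.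
  have -> : x ^+ 4 = x ^+ 2 ^+ 2 by ring.
  have -> : x ^+ 6 = x ^+ 2 ^+ 3 by ring.
  move: (x ^+ 2) u0 u1 => u u0 u1.
  rewrite -subr_ge0 (_ : _ - _ = u ^+ 3 * (1 - u) * (40 + 15 * u + 9 * u ^+ 2) / 64).
    by rewrite divr_ge0 ?mulr_ge0 ?exprn_ge0//; nra.
  by field.
have up : segint (-1) 1 halfcircle <=
    segint (-1) 1 (fun x => 1 - 1 / 2 * x ^+ 2 - 1 / 8 * x ^+ 4 - 1 / 16 * x ^+ 6).
  apply: le_segint => //; first by cont.
  move=> x x1; have h2 := sqr_halfcircle x1; have /andP[u0 u1] := sqr_le1 x1.
  have -> : x ^+ 4 = x ^+ 2 ^+ 2 by ring.
  have -> : x ^+ 6 = x ^+ 2 ^+ 3 by ring.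
  rewrite /halfcircle; move: (x ^+ 2) u0 u1 => u u0 u1.
  have p0 : 0 <= 1 - 1 / 2 * u - 1 / 8 * u ^+ 2 - 1 / 16 * u ^+ 3.
    have : u ^+ 2 <= 1 by rewrite exprn_ile1; lra.
    have : u ^+ 3 <= 1 by rewrite exprn_ile1; lra.
    lra.
  rewrite -[leRHS](ger0_norm p0) -sqrtr_sqr ler_wsqrtr//.
  rewrite -subr_ge0 (_ : _ - _ = u ^+ 4 * (20 + 4 * u + u ^+ 2) / 256).
    by rewrite divr_ge0 ?mulr_ge0 ?exprn_ge0//; nra.
  by field.
move: lo up; rewrite !polyint -E moment0; lra.
Qed.

End Oscillation.

(** * The Fourier transform of the sinh window *)

Lemma scale_bound {R : realType} (T M e X q : R) : 0 < T -> T <= 49 / 15 * M -> 0 <= M ->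
  3 <= q -> 0 <= e -> 11 / 10 * (q / 2) * e <= T * X -> e <= 2 * M * X.
Proof.
move=> T0 TM M0 q3 e0 H; have Me0 : 0 <= M * e by exact: mulr_ge0.
have h1 := ler_wpM2r e0 TM; have h2 := ler_wpM2r Me0 q3; have h3 := ler_wpM2l M0 H.
by rewrite -(ler_pM2l T0); lra.
Qed.

Lemma far_shift {R : realType} (x d : R) (j : nat) :
  - d <= x <= d -> d <= 2 / 5 -> 1 <= j%:R :> R ->
  j.+1%:R - d <= `|x + j.+1%:R| /\ j.+1%:R - d <= `|x - j.+1%:R|.
Proof.
move=> /andP[x1 x2] d2 j1; rewrite -natr1; split.
  by apply: le_trans (ler_norm _); lra.
by rewrite distrC; apply: le_trans (ler_norm _); lra.
Qed.

Lemma cube_4_5 {R : realType} : 8 * ((4 / 5) ^+ 3)^-1 <= 16 :> R.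
Proof. by rewrite (_ : 8 * _ = 125 / 8); [lra|field]. Qed.

Lemma sixteen_three {R : realType} (c z : R) : 0 < c -> z <= 3 -> 16 / c * z <= 48 / c.
Proof.
move=> c0 z3; rewrite mulrAC; apply: ler_wpM2r; first by rewrite invr_ge0 ltW.
by lra.
Qed.

Lemma alias_total {R : realType} (q c x1 x2 y z : R) :
  x1 <= q + x2 -> x2 <= 16 / c -> y <= z -> z <= 48 / c -> x1 + y <= q + 64 / c.
Proof. by move: (c^-1) => e; lra. Qed.

(** The numerical comparison behind the aliasing bound; [M] is [sqrt m], [s]
    the critical argument [2 pi m sqrt (1 - 1 / sigma)], [k] the window
    integral there, and [p ^ 2 = 2 pi m]. *)
Lemma alias_budget {R : realType} (T M p e en s k q : R) :
  41 / 29 <= M -> 22 / 9 * M <= p -> 3 <= q -> 0 < T -> T <= 49 / 15 * M ->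
  0 < s -> s <= 32 / 5 * (17 / 24) * M ^+ 2 -> 0 < e -> 0 < en -> en * e = 1 ->
  11 / 10 * (q / 2) * e <= T * (s * k) ->
  q / 2 + 64 / p ^+ 3 <= (24 * M ^+ 3 + 10) * en * k.
Proof.
move=> M0 Mp q3 T0 TM s0 sM e0 en0 ee K.
have M3 : 48 / 17 <= M ^+ 3.
  apply: (@le_trans _ _ ((41 / 29) ^+ 3)); first by lra.
  by apply: lerXn2r; rewrite ?nnegrE //; lra.
have p3 : 73 / 5 * M ^+ 3 <= p ^+ 3.
  apply: (@le_trans _ _ ((22 / 9 * M) ^+ 3)).
    by rewrite exprMn; apply: ler_wpM2r; lra.
  by apply: lerXn2r => //; rewrite nnegrE; lra.
have P3 : 0 < p ^+ 3 by lra.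
have Q0 : 0 < 64 / p ^+ 3 by apply: divr_gt0.
have qM : 64 / p ^+ 3 * M ^+ 3 <= 320 / 73.
  by rewrite mulrAC ler_pdivrMr//; lra.
move: (64 / p ^+ 3) Q0 qM => Q Q0 qM.
have Ts : T * s <= 49 / 15 * (32 / 5 * (17 / 24)) * M ^+ 3.
  have -> : 49 / 15 * (32 / 5 * (17 / 24)) * M ^+ 3 =
    (49 / 15 * M) * (32 / 5 * (17 / 24) * M ^+ 2) by ring.
  by apply: ler_pM => //; exact: ltW.
have Ts0 : 0 < T * s by exact: mulr_gt0.
have eps0 : 0 <= (24 * M ^+ 3 + 10) * en by apply: mulr_ge0; lra.
rewrite -(ler_pM2l Ts0).
have -> : T * s * ((24 * M ^+ 3 + 10) * en * k) =
  (24 * M ^+ 3 + 10) * en * (T * (s * k)) by ring.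
apply: le_trans (ler_wpM2l eps0 K).
have -> : (24 * M ^+ 3 + 10) * en * (11 / 10 * (q / 2) * e) =
  (24 * M ^+ 3 + 10) * (11 / 10 * (q / 2)) * (en * e) by ring.
rewrite ee mulr1; have T1 : 0 <= q / 2 + Q by lra.
apply: le_trans (ler_wpM2r T1 Ts) _.
have qM3 : 3 * (48 / 17) <= q * M ^+ 3 by apply: ler_pM; lra.
move: (M ^+ 3) qM M3 qM3 => Z; lra.
Qed.

Section WindowTransform.
Context {R : realType}.
Variables (m : nat) (sigma : R).
Hypotheses (m2 : (2 <= m)%N) (sigma_bnd : 5 / 4 <= sigma <= 2).
Implicit Types (x y xi v : R).

Local Notation b := (beta m sigma).
Local Notation P := (2 * pi * m%:R : R).
Local Notation s0 := (P * Num.sqrt (1 - 1 / sigma)).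

(** The Fourier transform of [omega_sinh (y / m)]: time is scaled so that the
    nodes of the quadrature are the integers. *)
Definition wft xi : R := segint (- m%:R) m%:R
  (fun y => omega_sinh m sigma (y / m%:R) * cos (2 * pi * xi * y)).

Let mR : 2 <= m%:R :> R. Proof. by rewrite (ler_nat R 2). Qed.

Let m_gt0 : 0 < m%:R :> R. Proof. by have := mR; lra. Qed.

Let P_gt0 : 0 < P.
Proof. by rewrite !mulr_gt0 ?pi_gt0. Qed.

Let sigma_gt0 : 0 < sigma. Proof. by case/andP: sigma_bnd => h _; lra. Qed.

Let d := 1 / (2 * sigma).

Let d_bnd : 1 / 4 <= d <= 2 / 5.
Proof.
by case/andP: sigma_bnd => h1 h2; rewrite /d ler_pdivlMr ?ler_pdivrMr ?mulr_gt0//; lra.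
Qed.

Let bE : b = P * (1 - d). Proof. by []. Qed.

Let b_gt0 : 0 < b.
Proof. by rewrite bE mulr_gt0//; have := d_bnd; lra. Qed.

Let sE : 1 - 1 / sigma = 1 - 2 * d.
Proof. by rewrite /d; field; rewrite gt_eqF. Qed.

Lemma sinh_gt0 x : 0 < x -> 0 < sinh x.
Proof. by move=> x0; rewrite divr_gt0// subr_gt0 ltr_expR; lra. Qed.

Lemma sinh0 : sinh (0 : R) = 0.
Proof. by rewrite /sinh oppr0 subrr mul0r. Qed.

Lemma sinh_cont : continuous (@sinh R).
Proof. by rewrite /sinh; cont. Qed.

(** The square root of a negative number is [0], so the cut-off of the window
    outside [[-1, 1]] is built into the formula, and continuity is immediate. *)
Lemma omega_sinhE x : omega_sinh m sigma x = sinh (b * halfcircle x) / sinh b.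
Proof.
rewrite /omega_sinh; case: ifPn => //; rewrite negb_and -!ltNge => x1.
rewrite /halfcircle ler0_sqrtr ?mulr0 ?sinh0 ?mul0r//.
rewrite subr_le0 -(expr1n _ 2) -ler_sqrt ?sqr_ge0// !sqrtr_sqr normr1.
by rewrite ler_normr; case/orP: x1 => /ltW h; apply/orP; [right; lra|left].
Qed.

Lemma omega_sinh_cont : continuous (omega_sinh m sigma).
Proof.
have ch := @halfcircle_cont R; have cs := sinh_cont.
rewrite (_ : omega_sinh m sigma = fun x => sinh (b * halfcircle x) / sinh b).
  by cont.
by apply/funext => x; exact: omega_sinhE.
Qed.

Lemma omega_sinhN x : omega_sinh m sigma (- x) = omega_sinh m sigma x.
Proof. by rewrite !omega_sinhE halfcircleN. Qed.

Lemma omega_sinh_eq0 x : 1 <= `|x| -> omega_sinh m sigma x = 0.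
Proof.
move=> x1; rewrite omega_sinhE /halfcircle ler0_sqrtr ?mulr0 ?sinh0 ?mul0r//.
by rewrite subr_le0 -(real_normK (num_real x)) exprn_ege1.
Qed.

Lemma sinh_le x y : x <= y -> sinh x <= sinh y.
Proof.
move=> xy; have := xy; rewrite -ler_expR => h1.
have : expR (- y) <= expR (- x) by rewrite ler_expR lerN2.
by rewrite /sinh; lra.
Qed.

Lemma omega_sinh_ge0_le1 x : 0 <= omega_sinh m sigma x <= 1.
Proof.
have sb := sinh_gt0 b_gt0.
have h1 : sinh (b * halfcircle x) <= sinh b.
  by apply: sinh_le; rewrite ler_piMr ?halfcircle_le1// ltW.
have h0 : 0 <= sinh (b * halfcircle x).
  by rewrite -sinh0; apply: sinh_le; rewrite mulr_ge0 ?halfcircle_ge0// ltW.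
by rewrite omega_sinhE divr_ge0 ?(ltW sb)//= ler_pdivrMr// mul1r.
Qed.

Lemma wft_wint xi :
  wft xi = m%:R * (b / sinh b) * wint (b ^+ 2 - (P * xi) ^+ 2) 0.
Proof.
have m0 := m_gt0.
have ch := @halfcircle_cont R; have cS := @sinhc_cont R.
have co := omega_sinh_cont.
rewrite /wft -[X in segint X _]mulrN1 -[X in segint _ X]mulr1.
rewrite segint_scale//; last by cont.
rewrite -[RHS]mulrA; congr (_ * _).
rewrite -(wintE _ (P * xi)) subrK -segintZ; last by cont.
apply: segint_eq => x x1; rewrite mulrAC divff ?gt_eqF// mul1r omega_sinhE.
have [h _] := sinhc_sinh_cosh (b * halfcircle x).
rewrite -h exprMn sqr_halfcircle// mulrA.
by rewrite (_ : 2 * pi * xi * (m%:R * x) = P * xi * x); ring.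
Qed.

Let pi3 : 3 <= (pi : R) <= 16 / 5. Proof. exact: pi_bounds. Qed.

Let root_bnd : 4 / 9 <= Num.sqrt (1 - 1 / sigma) <= 17 / 24.
Proof.
have dd := d_bnd; rewrite sE.
have H (y z : R) : 0 <= y -> y ^+ 2 <= z -> y <= Num.sqrt z.
  by move=> y0 yz; rewrite -[y]ger0_norm// -sqrtr_sqr ler_wsqrtr.
apply/andP; split; first by apply: H; lra.
have H2 : 0 <= 17 / 24 :> R by lra.
by rewrite -[leRHS]ger0_norm// -sqrtr_sqr ler_wsqrtr//; lra.
Qed.

Let s0_ge5 : 5 <= s0.
Proof.
have /andP[p3 _] := pi3; have /andP[r1 _] := root_bnd; have m2' := mR.
apply: (@le_trans _ _ (2 * 3 * 2 * (4 / 9))); first by lra.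
have P12 : 2 * 3 * 2 <= P.
  by rewrite -!mulrA; apply: ler_wpM2l; [lra|apply: ler_pM; lra].
by apply: ler_pM; lra.
Qed.

Let sqr_s0 : s0 ^+ 2 = P ^+ 2 * (1 - 2 * d).
Proof. by rewrite exprMn sqr_sqrtr sE//; have := d_bnd; lra. Qed.

Let freqE v : b ^+ 2 - (P * v) ^+ 2 = P ^+ 2 * ((1 - d) ^+ 2 - v ^+ 2).
Proof. by rewrite bE; ring. Qed.

Let freqNE v : (P * v) ^+ 2 - b ^+ 2 = P ^+ 2 * (v ^+ 2 - (1 - d) ^+ 2).
Proof. by rewrite bE; ring. Qed.

Let P2_ge0 : 0 <= P ^+ 2. Proof. exact: sqr_ge0. Qed.

Let s0_le_b : s0 <= b.
Proof.
have h := s0_ge5; have hb := b_gt0.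
rewrite -(ler_pXn2r (n := 2))// ?nnegrE; [|lra|exact: ltW].
rewrite sqr_s0 bE (exprMn _ P) ler_wpM2l//.
by rewrite -subr_ge0 (_ : _ - _ = d ^+ 2) ?sqr_ge0//; ring.
Qed.

Let expR_s0 : 99 / 200 * expR s0 <= expR s0 / 2 - expR (- s0).
Proof.
have h := s0_ge5; move: s0 h => s h.
have H1 : 200 <= expR s * expR s.
  rewrite -expRD (_ : s + s = 8%:R * (s / 4)); last by field.
  rewrite expRM_natl; apply: (@le_trans _ _ ((9 / 4) ^+ 8)); first by lra.
  by apply: lerXn2r; rewrite ?nnegrE ?expR_ge0//; apply: le_trans (expR_ge1Dx _); lra.
have E : expR s * expR (- s) = 1 by rewrite -expRD subrr expR0.
have e0 := expR_gt0 s; have e1 := expR_gt0 (- s).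
have : 200 * expR (- s) <= expR s * expR s * expR (- s) by rewrite ler_wpM2r// ltW.
by rewrite -mulrA E mulr1; lra.
Qed.

Local Notation k0 := (wint (s0 ^+ 2) 0).

(** Lower bound at the critical frequency [|xi| = 1 / (2 sigma)]. *)
Let k0_ge : 11 / 10 * (pi / 2) * expR s0 <= Num.sqrt (2 * s0 + 3) * (s0 * k0).
Proof.
have h := s0_ge5; have /andP[p3 _] := pi3.
have t0 : 0 < Num.sqrt (2 * s0 + 3) by rewrite sqrtr_gt0; lra.
have s00 : 0 < s0 by lra.
have H := wint0_ge_exp s00; rewrite -(ler_pM2l t0) in H; apply: le_trans H.
have H5 : 20 / 9 <= Num.sqrt 5 :> R.
  have H2 : 0 <= 20 / 9 :> R by lra.
  by rewrite -[leLHS]ger0_norm// -sqrtr_sqr ler_wsqrtr//; lra.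
have e0 := expR_gt0 s0; have He := expR_s0.
have e1 : 0 <= 99 / 200 * expR s0 by apply: mulr_ge0; [lra|exact: ltW].
move: (expR s0 / 2 - expR (- s0)) He => X He.
rewrite (_ : _ * (_ * X) = Num.sqrt 5 * X * (pi / 2)); last by field; rewrite gt_eqF.
rewrite mulrAC; apply: ler_wpM2r; first by lra.
apply: (@le_trans _ _ (20 / 9 * (99 / 200 * expR s0))); first by lra.
by apply: ler_pM; [lra|exact: e1|exact: H5|exact: He].
Qed.

Let k0_gt0 : 0 < k0.
Proof.
have h := s0_ge5; have /andP[p3 _] := pi3.
have t0 : 0 < Num.sqrt (2 * s0 + 3) * s0.
  by rewrite mulr_gt0 ?sqrtr_gt0; lra.
have K := k0_ge; have e0 := expR_gt0 s0.
rewrite -(pmulr_rgt0 _ t0) -(mulrA (Num.sqrt (2 * s0 + 3)) s0); apply: lt_le_trans K.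
by apply: mulr_gt0; [lra|exact: e0].
Qed.

Let wint_mid xi : - d <= xi <= d -> k0 <= wint (b ^+ 2 - (P * xi) ^+ 2) 0.
Proof.
move=> xid; apply: wint_le; rewrite sqr_ge0/= sqr_s0 freqE; apply: ler_wpM2l => //.
have : xi ^+ 2 <= d ^+ 2.
  have dd := d_bnd; have d0 : 0 <= d by lra.
  rewrite -(real_normK (num_real xi)); apply: lerXn2r; rewrite ?nnegrE//.
  by rewrite ler_norml.
by lra.
Qed.

Let c_gt0 : 0 < m%:R * (b / sinh b).
Proof.
apply: mulr_gt0; first exact: m_gt0.
by apply: divr_gt0; [exact: b_gt0|exact: sinh_gt0 b_gt0].
Qed.

(** For [|xi| <= 1 / (2 sigma)] the argument [b ^ 2 - (P xi) ^ 2] is at least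
    [s0 ^ 2], so the window integral is in its growing regime. *)
Lemma wft_gt0 xi : - (1 / (2 * sigma)) <= xi <= 1 / (2 * sigma) -> 0 < wft xi.
Proof.
move=> xid; rewrite wft_wint; apply: mulr_gt0; first exact: c_gt0.
exact: lt_le_trans k0_gt0 (wint_mid xid).
Qed.

Local Notation mu := (Num.sqrt (m%:R : R)).
Local Notation p := (Num.sqrt P).

Let mu_sqr : mu ^+ 2 = m%:R.
Proof. by rewrite sqr_sqrtr. Qed.

Let mu_ge : 41 / 29 <= mu.
Proof.
have H2 : 0 <= 41 / 29 :> R by lra.
by rewrite -[leLHS]ger0_norm// -sqrtr_sqr ler_wsqrtr//; have := mR; lra.
Qed.

Let s0_le : s0 <= 32 / 5 * (17 / 24) * mu ^+ 2.
Proof.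
have /andP[_ p3] := pi3; have /andP[r1 r2] := root_bnd; have m2' := m_gt0.
rewrite mu_sqr.
have -> : s0 = 2 * pi * Num.sqrt (1 - 1 / sigma) * m%:R by ring.
apply: ler_wpM2r; first exact: ltW.
apply: ler_pM; [by rewrite mulr_ge0// pi_ge0|lra|lra|lra].
Qed.

Let root_s0_le : Num.sqrt (2 * s0 + 3) <= 49 / 15 * mu.
Proof.
have h := s0_le; have m2' := mu_ge; have m3 := mu_sqr; have m4 := mR.
have H : 0 <= 49 / 15 * mu by lra.
by rewrite -[leRHS]ger0_norm// -sqrtr_sqr ler_wsqrtr// exprMn; lra.
Qed.

(** Here [s0 <= 32 / 5 * 17 / 24 * m], so [sqrt (2 s0 + 3)] is a multiple of
    [sqrt m]. *)
Let exp_s0_le : expR s0 <= 2 * mu * (s0 * k0).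
Proof.
have h5 := s0_ge5; have /andP[p3 _] := pi3.
apply: (@scale_bound _ (Num.sqrt (2 * s0 + 3)) mu (expR s0) (s0 * k0) pi) => //.
by move: s0 h5 => s h; rewrite sqrtr_gt0; lra.
Qed.

(** From [b / sinh b >= 2 b exp (- b)] and [b >= s0]; [2 s0 exp (- b) k0] then
    carries the two exponentials. *)
Lemma wft_ge xi : - (1 / (2 * sigma)) <= xi <= 1 / (2 * sigma) ->
  mu * expR (s0 - b) <= wft xi.
Proof.
move=> xid; have kx := wint_mid xid; rewrite wft_wint.
have H2 := exp_s0_le; have hk := ltW k0_gt0; have sb := s0_le_b.
have hb := b_gt0; have e1 := ltW (expR_gt0 (- b)).
have m0 := ltW m_gt0.
have H1 : 2 * b * expR (- b) <= b / sinh b.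
  rewrite ler_pdivlMr ?sinh_gt0// /sinh.
  have E : expR (- b) * expR b = 1 by rewrite -expRD addNr expR0.
  have -> : 2 * b * expR (- b) * ((expR b - expR (- b)) / 2) =
    b * (expR (- b) * expR b) - b * expR (- b) ^+ 2 by field.
  by rewrite E mulr1 gerBl; apply: mulr_ge0; [exact: ltW|exact: sqr_ge0].
have c0 : 0 <= m%:R * (b / sinh b) by exact/ltW/c_gt0.
apply: le_trans (ler_wpM2l c0 kx); apply: (@le_trans _ _ (m%:R * (2 * b * expR (- b)) * k0)).
  rewrite expRD -[X in _ <= X * _ * _]mu_sqr.
  have mue0 : 0 <= mu * expR (- b) by apply: mulr_ge0 => //; exact: sqrtr_ge0.
  have -> : mu * (expR s0 * expR (- b)) = mu * expR (- b) * expR s0.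
    by move: (expR s0) => X; rewrite -mulrA [X in _ * X]mulrC.
  apply: le_trans (ler_wpM2l mue0 H2) _.
  have ce0 : 0 <= 2 * mu ^+ 2 * expR (- b) * k0.
    by apply: mulr_ge0 => //; apply: mulr_ge0 => //; rewrite mu_sqr; apply: mulr_ge0.
  have := ler_wpM2l ce0 sb; move: s0 b k0 (expR (- b)) mu => s c k e M.
  have -> : 2 * M ^+ 2 * e * k * s = M * e * (2 * M * (s * k)) by ring.
  by have -> : 2 * M ^+ 2 * e * k * c = M ^+ 2 * (2 * c * e) * k by ring.
by apply: ler_wpM2r => //; apply: ler_wpM2l.
Qed.

Let p_sqr : p ^+ 2 = P.
Proof. by rewrite sqr_sqrtr// ltW. Qed.

Let p_ge : 22 / 9 * mu <= p.
Proof.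
have /andP[p3 _] := pi3; have m3 := mu_sqr; have m4 := mR; have mu0 := mu_ge.
have H : 0 <= 22 / 9 * mu by lra.
rewrite -[leLHS]ger0_norm// -sqrtr_sqr ler_wsqrtr// exprMn m3.
apply: ler_wpM2r; [by lra|by lra].
Qed.

(** A frequency [v] beyond the cut-off is measured by the factor [g] in
    [(P v)^2 - b^2 >= (g^2 P)^2]; with [p^2 = P] this puts the argument of
    the decay estimate at [g p] or more. *)
Let decay g v : 0 < g -> 1 <= g * p -> g ^+ 4 * P ^+ 2 <= (P * v) ^+ 2 - b ^+ 2 ->
  `|wint (b ^+ 2 - (P * v) ^+ 2) 0| <= 8 / (g * p) ^+ 3.
Proof.
move=> g0 gp H; have p0 : 0 < p by rewrite sqrtr_gt0.
have gp0 : 0 <= (g * p) ^+ 4 by rewrite exprn_ge0// mulr_ge0// ltW.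
have E : (g * p) ^+ 4 = g ^+ 4 * P ^+ 2 by rewrite exprMn (exprM p 2 2) p_sqr.
rewrite -E in H.
pose z := Num.sqrt ((P * v) ^+ 2 - b ^+ 2); pose q := Num.sqrt z.
have z2 : z ^+ 2 = (P * v) ^+ 2 - b ^+ 2 by rewrite sqr_sqrtr//; lra.
have q2 : q ^+ 2 = z by rewrite sqr_sqrtr// sqrtr_ge0.
have q0 : 0 <= q by exact: sqrtr_ge0.
have q4 : q ^+ 4 = (P * v) ^+ 2 - b ^+ 2 by rewrite -z2 -q2 -exprM.
have qg : g * p <= q.
  by rewrite -(ler_pXn2r (n := 4))// ?nnegrE ?q4//; lra.
have q1 : 1 <= q by exact: le_trans qg.
rewrite (_ : b ^+ 2 - _ = - (q ^+ 2) ^+ 2); last by rewrite -exprM q4 opprB.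
apply: le_trans (normr_wint_neg_decay q1) _.
apply: ler_wpM2l; first by lra.
rewrite lef_pV2 ?posrE ?exprn_gt0//; [|lra|lra].
by apply: lerXn2r; rewrite ?nnegrE//; lra.
Qed.

Let alias v := `|wint (b ^+ 2 - (P * v) ^+ 2) 0|.

Let aliasN v : alias (- v) = alias v.
Proof. by rewrite /alias mulrN sqrrN. Qed.

Let p_ge3 : 2 <= p.
Proof. by have := p_ge; have := mu_ge; lra. Qed.

(** With [j + 1] for the shift, [(j + 1 - d)^2 - (1 - d)^2 = j (j + 2 - 2 d)] is
    at least [j^2], so [g = sqrt j] is admissible and the shifts are summable
    like [j^(-3/2)]. *)
Let alias_far v (j : nat) : (0 < j)%N -> j.+1%:R - d <= `|v| ->
  alias v <= 8 * (Num.sqrt (j%:R : R) ^+ 3)^-1 / p ^+ 3.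
Proof.
move=> j0 jv; have dd := d_bnd; have pp := p_ge3.
have j1 : 1 <= j%:R :> R by rewrite (ler_nat R 1).
have sj : 1 <= Num.sqrt (j%:R : R) by rewrite -[leLHS]sqrtr1 ler_wsqrtr.
rewrite -mulrA -invfM -exprMn; apply: decay; [lra|nra|].
have -> : Num.sqrt (j%:R : R) ^+ 4 = j%:R ^+ 2.
  by rewrite (exprM _ 2 2) sqr_sqrtr.
rewrite freqNE mulrC; apply: ler_wpM2l => //.
have : (j.+1%:R - d) ^+ 2 <= v ^+ 2.
  by rewrite -(real_normK (num_real v)) lerXn2r ?nnegrE//; rewrite -natr1; lra.
rewrite lerBrDr; apply: le_trans.
rewrite -subr_ge0 -natr1 (_ : _ - _ = 2 * j%:R * (1 - d)); last by ring.
by rewrite !mulr_ge0//; lra.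
Qed.

(** The two shifts by one: the nearest alias sits at the edge of the
    oscillatory regime, where only the trivial bound is available. *)
Let alias_near xi : - d <= xi <= d -> alias (xi + 1) + alias (xi - 1) <=
  pi / 2 + 8 / (4 / 5 * p) ^+ 3.
Proof.
wlog xi0 : xi / 0 <= xi => [H|xid].
  have [/H//|xi0 xid] := leP 0 xi.
  have xiN : - d <= - xi <= d by rewrite lerN2 lerNl andbC.
  have xi0N : 0 <= - xi by rewrite oppr_ge0 ltW.
  move: (H (- xi) xi0N xiN).
  have -> : alias (- xi + 1) = alias (xi - 1) by rewrite -aliasN opprD opprK.
  have -> : alias (- xi - 1) = alias (xi + 1) by rewrite -opprD aliasN.
  by move=> H2; rewrite [X in X <= _]addrC.
have dd := d_bnd; have pp := p_ge3.
rewrite addrC; apply: lerD.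
  rewrite /alias; set w := b ^+ 2 - _.
  have w0 : w <= 0.
    rewrite /w freqE; apply: mulr_ge0_le0 => //.
    rewrite (_ : _ - _ = (xi - d) * (2 - d - xi)); last by ring.
    by rewrite mulr_le0_ge0//; lra.
  rewrite (_ : w = - (Num.sqrt (- w)) ^+ 2); first exact: normr_wint_neg.
  by rewrite sqr_sqrtr ?opprK// oppr_ge0.
apply: decay; [lra|lra|].
rewrite freqNE mulrC; apply: ler_wpM2l => //.
have : 1 <= (xi + 1) ^+ 2 by rewrite expr_ge1//; lra.
have : (1 - d) ^+ 2 <= (3 / 4) ^+ 2 by rewrite lerXn2r ?nnegrE//; lra.
by lra.
Qed.

(** Telescoping: [j^(-3/2) <= 2 / sqrt (j - 1) - 2 / sqrt j]. *)
Let zeta_sum n : (0 < n)%N ->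
  \sum_(1 <= j < n.+1) (Num.sqrt (j%:R : R) ^+ 3)^-1 <= 3 - 2 / Num.sqrt (n%:R : R).
Proof.
elim: n => // -[|n] IH _.
  by rewrite big_nat1 sqrtr1 expr1n invr1; lra.
rewrite big_nat_recr//=; apply: le_trans (lerD (IH isT) (lexx _)) _.
set x := Num.sqrt _; set y := Num.sqrt _.
have x0 : 0 < x by rewrite sqrtr_gt0.
have y0 : 0 < y by rewrite sqrtr_gt0.
have xy : y ^+ 2 = x ^+ 2 + 1 by rewrite !sqr_sqrtr// -natr1.
have le_xy : x <= y by rewrite ler_wsqrtr// ler_nat.
rewrite -subr_ge0.
have -> : 3 - 2 / y - (3 - 2 / x + (y ^+ 3)^-1) =
   (2 * y ^+ 2 * (y - x) - x) / (x * y ^+ 3).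
  by field; rewrite !gt_eqF.
rewrite divr_ge0//; last by rewrite mulr_ge0 ?exprn_ge0// ltW.
have s0 : 0 < y + x by rewrite addr_gt0.
have E : (y - x) * (y + x) = 1 by rewrite -subr_sqr xy; ring.
rewrite -(pmulr_lge0 _ s0).
rewrite (_ : _ * (y + x) = 2 * y ^+ 2 * ((y - x) * (y + x)) - x * y - x ^+ 2); last by ring.
rewrite E mulr1.
have : x * y <= y * y by rewrite ler_wpM2r// ltW.
by rewrite -expr2; lra.
Qed.

Let alias_sum xi n : - d <= xi <= d ->
  \sum_(1 <= r < n.+1) (alias (xi + r%:R) + alias (xi - r%:R)) <= pi / 2 + 64 / p ^+ 3.
Proof.
move=> xid; have /andP[pi0 _] := pi3; have pp := p_ge3; have dd := d_bnd.
have p3 : 0 < p ^+ 3 by rewrite exprn_gt0//; lra.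
have ip3 : 0 < (p ^+ 3)^-1 by rewrite invr_gt0.
case: n => [|n].
  by rewrite big_nil addr_ge0 ?divr_ge0 ?ltW//; lra.
rewrite big_ltn// big_add1/=.
have N1 := alias_near xid.
have E1 : 8 / (4 / 5 * p) ^+ 3 <= 16 / p ^+ 3.
  rewrite exprMn invfM mulrA; apply: ler_wpM2r; first exact: ltW.
  exact: cube_4_5.
have far : \sum_(1 <= i < n.+1) (alias (xi + i.+1%:R) + alias (xi - i.+1%:R)) <=
   \sum_(1 <= i < n.+1) 16 / p ^+ 3 * (Num.sqrt (i%:R : R) ^+ 3)^-1.
  apply: ler_sum_nat => j /andP[j0 _].
  have j1 : 1 <= j%:R :> R by rewrite (ler_nat R 1).
  have h1 : alias (xi + j.+1%:R) <= 8 * (Num.sqrt (j%:R : R) ^+ 3)^-1 / p ^+ 3.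
    by apply: alias_far => //; case: (far_shift xid (proj2 (andP dd)) j1).
  have h2 : alias (xi - j.+1%:R) <= 8 * (Num.sqrt (j%:R : R) ^+ 3)^-1 / p ^+ 3.
    by apply: alias_far => //; case: (far_shift xid (proj2 (andP dd)) j1).
  apply: le_trans (lerD h1 h2) _; rewrite le_eqVlt; apply/orP; left; apply/eqP.
  by move: (_ ^-1) (_ ^-1) => A B; ring.
have Z : \sum_(1 <= i < n.+1) 16 / p ^+ 3 * (Num.sqrt (i%:R : R) ^+ 3)^-1 <= 48 / p ^+ 3.
  rewrite -mulr_sumr; case: n {far} => [|n].
    by rewrite big_nil mulr0 divr_ge0// ltW.
  have := zeta_sum (ltn0Sn n); have : 0 <= 2 / Num.sqrt (n.+1%:R : R) by rewrite divr_ge0.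
  move: (\sum_(_ <= _ < _) _) => Z.
  by move=> z0 z1; apply: sixteen_three => //; apply: le_trans z1 _; rewrite gerBl.
exact: alias_total N1 E1 far Z.
Qed.

Let normr_wft v : `|wft v| = m%:R * (b / sinh b) * alias v.
Proof. by rewrite wft_wint normrM (ger0_norm (ltW c_gt0)). Qed.

(** All alias frequencies lie in the oscillatory regime, where the window
    integral is at most [pi / 2] and mostly much smaller, whereas at [xi] itself
    it is exponentially large in [s0]. The factor [b / sinh b] cancels. *)
Lemma wft_aliasing xi n : - (1 / (2 * sigma)) <= xi <= 1 / (2 * sigma) ->
  \sum_(1 <= r < n.+1) (`|wft (xi + r%:R)| + `|wft (xi - r%:R)|) <=
  (24 * m%:R `^ (3 / 2) + 10) * expR (- s0) * wft xi.
Proof.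
move=> xid; have kx := wint_mid xid; have ks := alias_sum n xid.
have c0 := ltW c_gt0.
under eq_bigr do rewrite !normr_wft -mulrDr.
rewrite -mulr_sumr wft_wint [X in _ <= X]mulrCA; apply: ler_wpM2l => //.
have -> : m%:R `^ (3 / 2) = mu ^+ 3.
  by rewrite -powR12_sqrt// -powR_mulrn ?powR_ge0// -powRrM; congr (_ `^ _); field.
apply: le_trans ks _.
apply: (@le_trans _ _ ((24 * mu ^+ 3 + 10) * expR (- s0) * k0)); last first.
  by apply: ler_wpM2l kx; rewrite mulr_ge0 ?expR_ge0.
have s00 : 0 < s0 by apply: lt_le_trans s0_ge5.
have /andP[q3 _] := pi3.
apply: (alias_budget mu_ge p_ge q3 _ root_s0_le s00 s0_le _ _ _ k0_ge).
- by rewrite sqrtr_gt0 addr_gt0// mulr_gt0.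
- exact: expR_gt0.
- exact: expR_gt0.
- by rewrite -expRD addNr expR0.
Qed.

End WindowTransform.

(** * The Fejer kernel *)

Section Fejer.
Context {R : realType}.
Implicit Types (u t : R) (n k r : nat).

Definition dirichlet k u : R := 1 + 2 * \sum_(1 <= r < k.+1) cos (2 * pi * r%:R * u).

(** [n] times the Fejer kernel. *)
Definition fejer n u : R := \sum_(0 <= k < n) dirichlet k u.

Lemma fejer_cont n : continuous (fejer n).
Proof. by rewrite /fejer /dirichlet; cont. Qed.

Lemma sin_dirichlet k u :
  sin (pi * u) * dirichlet k u = sin ((2 * k%:R + 1) * pi * u).
Proof.
elim: k => [|k IH].
  have -> : (2 * 0%:R + 1) * pi * u = pi * u by ring.
  by rewrite /dirichlet big_geq//; ring.
have -> : dirichlet k.+1 u = dirichlet k u + 2 * cos (2 * pi * k.+1%:R * u).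
  by rewrite /dirichlet big_nat_recr//= mulrDr addrA.
rewrite mulrDr IH -(natr1 k).
have -> : (2 * k%:R + 1) * pi * u = 2 * pi * (k%:R + 1) * u - pi * u by ring.
have -> : (2 * (k%:R + 1) + 1) * pi * u = 2 * pi * (k%:R + 1) * u + pi * u by ring.
by rewrite sinB sinD; ring.
Qed.

Lemma sin_fejer n u :
  sin (pi * u) ^+ 2 * fejer n u = (1 - cos (2 * pi * n%:R * u)) / 2.
Proof.
elim: n => [|n IH].
  have -> : 2 * pi * 0%:R * u = 0 by ring.
  by rewrite /fejer big_geq// cos0; ring.
rewrite /fejer big_nat_recr//= -/(fejer n u) mulrDr IH (expr2 (sin _)) -(mulrA (sin _) (sin _)) sin_dirichlet -(natr1 n).
have -> : (2 * n%:R + 1) * pi * u = 2 * pi * n%:R * u + pi * u by ring.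
have -> : 2 * pi * (n%:R + 1) * u = (2 * pi * n%:R * u + pi * u) + pi * u by ring.
rewrite (cosD (_ + pi * u)) (cosD (2 * pi * n%:R * u)) sinD.
have := cos2Dsin2 (pi * u) => /eqP; rewrite -subr_eq0 => /eqP h.
move: (cos (2 * _ * _ * u)) (sin (2 * _ * _ * u)) => C S.
transitivity ((1 - ((C * cos (pi * u) - S * sin (pi * u)) * cos (pi * u)
  - (S * cos (pi * u) + C * sin (pi * u)) * sin (pi * u))) / 2
  + C / 2 * (cos (pi * u) ^+ 2 + sin (pi * u) ^+ 2 - 1)).
  by field.
by rewrite h mulr0 addr0.
Qed.

Lemma pi_half_itv u : - (1 / 2) <= u <= 1 / 2 -> pi * u \in `[- (pi / 2), pi / 2].
Proof.
move=> /andP[u1 u2]; have p0 := pi_ge0 R; rewrite in_itv/=.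
by have := ler_wpM2l p0 u1; have := ler_wpM2l p0 u2; lra.
Qed.

Lemma sin_pi_eq0 u : -(1 / 2) <= u <= 1 / 2 -> sin (pi * u) = 0 -> u = 0.
Proof.
move=> /andP[u1 u2] s0; have p0 := pi_gt0 R.
have H := pi_half_itv.
have : pi * u = pi * 0.
  apply: sin_inj; rewrite ?H ?u1 ?u2//; last by rewrite s0 mulr0 sin0.
  by apply/andP; split; lra.
by move/mulfI; apply; rewrite gt_eqF.
Qed.

(** [fejer n u = (sin (n pi u) / sin (pi u))^2], away from the zero of the
    denominator. *)
Lemma fejer_ge0 n u : -(1 / 2) <= u <= 1 / 2 -> 0 <= fejer n u.
Proof.
move=> u1; have [s0|s0] := eqVneq (sin (pi * u)) 0.
  rewrite (sin_pi_eq0 u1 s0) /fejer sumr_ge0// => k _.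
  by rewrite /dirichlet addr_ge0// mulr_ge0// sumr_ge0// => r _; rewrite mulr0 cos0.
have h : 0 < sin (pi * u) ^+ 2 by rewrite lt0r sqrf_eq0 s0 sqr_ge0.
rewrite -(pmulr_rge0 _ h) sin_fejer divr_ge0// subr_ge0; exact: cos_le1.
Qed.

Lemma sin_natpi r : sin (pi * r%:R : R) = 0.
Proof.
elim: r => [|r IH]; first by rewrite mulr0 sin0.
by rewrite -(natr1 r) mulrDr mulr1 sinDpi IH oppr0.
Qed.

Local Notation halfint f := (segint (- (1 / 2)) (1 / 2) f).

Lemma int_cos r : (0 < r)%N -> halfint (fun u => cos (2 * pi * r%:R * u)) = 0.
Proof.
move=> r0; have p0 := pi_gt0 R.
have w0 : 2 * pi * r%:R != 0 :> R by rewrite !mulf_neq0// ?gt_eqF// ltr0n.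
pose F u : R := sin (2 * pi * r%:R * u) / (2 * pi * r%:R).
have E : 2 * pi * r%:R * (1 / 2) = pi * r%:R :> R by field.
transitivity (F (1 / 2) - F (- (1 / 2))); last first.
  by rewrite /F mulrN sinN E sin_natpi oppr0 mul0r subrr.
apply: segint_FTC; [lra|by cont|by rewrite /F; cont|].
move=> x _; rewrite /F; der.
by rewrite !mulr0 add0r addr0 mulr1 mulrC mulfK.
Qed.

Variable g : R -> R.
Hypothesis cg : continuous g.

Definition fcoef r : R := halfint (fun u => g u * cos (2 * pi * r%:R * u)).

Lemma int_mul_fejer n : halfint (fun u => g u * fejer n u) =
  \sum_(0 <= k < n) (fcoef 0 + \sum_(1 <= r < k.+1) 2 * fcoef r).
Proof.
transitivity (halfint (fun u => \sum_(0 <= k < n) (g u * cos (2 * pi * 0%:R * u) +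
    \sum_(1 <= r < k.+1) 2 * (g u * cos (2 * pi * r%:R * u))))).
  apply: segint_eq => u _; rewrite /fejer mulr_sumr; apply: eq_bigr => k _.
  rewrite /dirichlet mulrDr mulr0 mul0r cos0; congr (_ + _).
  by rewrite mulrCA !mulr_sumr; apply: eq_bigr => r _; ring.
rewrite segint_sum; last by move=> k; cont.
apply: eq_bigr => k _; rewrite segintD; [|by cont|by cont].
congr (_ + _); rewrite segint_sum; last by move=> r; cont.
by apply: eq_bigr => r _; rewrite segintZ//; cont.
Qed.

End Fejer.

Section FejerBound.
Context {R : realType}.
Implicit Types (u : R) (n k r : nat).

Local Notation halfint f := (segint (- (1 / 2)) (1 / 2) f).

Lemma int_fejer n : halfint (fejer n) = n%:R :> R.
Proof.
have c1 : continuous (fun _ : R => 1 : R) by cont.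
transitivity (halfint (fun u => 1 * fejer n u)).
  by apply: segint_eq => u _; rewrite mul1r.
rewrite int_mul_fejer// (eq_bigr (fun=> 1)); first by rewrite sumr_const_nat subn0.
move=> k _; rewrite big_nat_cond big1 => [|r /andP[/andP[r1 _] _]].
  rewrite addr0 /fcoef; transitivity (halfint (fun=> 1 : R)).
    by apply: segint_eq => u _; rewrite mulr0 mul0r cos0 mulr1.
  by rewrite segint_cst; lra.
rewrite /fcoef -[RHS](mulr0 2); congr (_ * _); rewrite -[RHS](int_cos r1).
by apply: segint_eq => u _; rewrite mul1r.
Qed.

(** The majorant [e + L sin (pi u)^2] is adapted to the Fejer kernel: [fejer n]
    has integral [n], while [sin (pi u)^2 * fejer n u] stays below [1]. *)
Lemma modulus_sin (g : R -> R) (e : R) : continuous g -> 0 < e ->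
  exists L : R, 0 <= L /\ forall u, -(1 / 2) <= u <= 1 / 2 ->
    `|g u - g 0| <= e + L * sin (pi * u) ^+ 2.
Proof.
move=> cg e0; have p0 := pi_gt0 R.
have [B [B0 HB]] := bounded_on_segment (1 / 2) cg.
have /cvgrPdist_le /(_ e e0) [/= d0 d0p Hd0] := cg 0.
pose d := Num.min (d0 / 2) (1 / 4).
have d_gt0 : 0 < d by rewrite lt_min divr_gt0//=; lra.
have d_le : d <= 1 / 4 by rewrite ge_min lexx orbT.
have d_lt : d < d0 by rewrite gt_min; apply/orP; left; lra.
have sd : 0 < sin (pi * d).
  apply: sin_gt0_pi; rewrite mulr_gt0//= -[X in _ < X]mulr1 ltr_pM2l//; lra.
exists (2 * B / sin (pi * d) ^+ 2); split.
  by rewrite divr_ge0 ?sqr_ge0// mulr_ge0.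
move=> u u1; have [ud|ud] := ltP `|u| d.
  have : `|g 0 - g u| <= e.
    by apply: Hd0; rewrite /= sub0r normrN; exact: lt_trans d_lt.
  rewrite distrC => h; apply: le_trans h _; rewrite lerDl mulr_ge0 ?sqr_ge0//.
  by rewrite divr_ge0 ?sqr_ge0// mulr_ge0.
have nu : `|u| <= 1 / 2 by rewrite ler_norml.
have hu : `|g u - g 0| <= 2 * B.
  apply: le_trans (ler_normB _ _) _; rewrite mulrDl !mul1r; apply: lerD; apply: HB => //.
  by rewrite normr0; lra.
have H := pi_half_itv.
have ss : sin (pi * d) ^+ 2 <= sin (pi * u) ^+ 2.
  have -> : sin (pi * u) ^+ 2 = sin (pi * `|u|) ^+ 2.
    by case: (ger0P u) => // _; rewrite mulrN sinN sqrrN.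
  have le_s : sin (pi * d) <= sin (pi * `|u|).
    rewrite leNgt ltr_sin ?H//; [|by rewrite nu andbT; have := normr_ge0 u; lra|by apply/andP; split; lra].
    by rewrite ltr_pM2l// -leNgt.
  by rewrite lerXn2r// nnegrE ltW//; exact: lt_le_trans le_s.
apply: le_trans hu _; rewrite -[leLHS]add0r; apply: lerD; first exact: ltW.
have s2 : 0 < sin (pi * d) ^+ 2 by rewrite exprn_gt0.
rewrite mulrAC ler_pdivlMr// ler_wpM2l//; lra.
Qed.

(** The value of a continuous function at [0] differs from its mean value by
    at most the sum of the moduli of the other Fourier coefficients: integrate
    against the Fejer kernel, whose Fourier coefficients lie in [[0, 1]]. *)
Lemma fourier_dist_mean (g : R -> R) (T : R) : continuous g ->
  (forall n, \sum_(1 <= r < n.+1) `|2 * fcoef g r| <= T) ->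
  `|g 0 - fcoef g 0| <= T.
Proof.
move=> cg HT; apply/ler_addgt0Pr => e e0.
have e2 : 0 < e / 2 by lra.
have [L [L0 HL]] := modulus_sin cg e2.
have h12 : - (1 / 2) <= 1 / 2 :> R by lra.
(* [n] times the claim, up to an error [n e / 2 + L]; [L] does not depend on
   [n]. *)
have main n : n%:R * `|g 0 - fcoef g 0| <= n%:R * T + (e / 2 * n%:R + L).
  have cF := @fejer_cont R n.
  have A1 : `|halfint (fun u => g u * fejer n u) - n%:R * fcoef g 0| <= n%:R * T.
    rewrite int_mul_fejer//.
    have -> : n%:R * fcoef g 0 = \sum_(0 <= k < n) fcoef g 0.
      by rewrite sumr_const_nat subn0 mulr_natl.
    have -> : n%:R * T = \sum_(0 <= k < n) T.
      by rewrite sumr_const_nat subn0 mulr_natl.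
    rewrite -sumrB; apply: le_trans (ler_norm_sum _ _ _) _; apply: ler_sum => k _.
    rewrite addrAC subrr add0r; exact: le_trans (ler_norm_sum _ _ _) (HT k).
  have A2 : `|halfint (fun u => g u * fejer n u) - n%:R * g 0| <= e / 2 * n%:R + L.
    have -> : n%:R * g 0 = halfint (fun u => g 0 * fejer n u).
      by rewrite segintZ// int_fejer mulrC.
    rewrite -segintB; [|by cont|by cont].
    apply: (@le_trans _ _ (halfint (fun u => e / 2 * fejer n u + L))).
      apply: normr_segint; [by cont|by cont|] => u u1.
      rewrite -mulrBl normrM (ger0_norm (fejer_ge0 n u1)).
      apply: le_trans (ler_wpM2r (fejer_ge0 n u1) (HL u u1)) _.
      rewrite mulrDl lerD2l -mulrA sin_fejer -[leRHS]mulr1 ler_wpM2l//.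
      by have := cos_geN1 (2 * pi * n%:R * u); lra.
    rewrite segintD; [|by cont|by cont].
    by rewrite segintZ// int_fejer segint_cst//; lra.
  rewrite -[X in X * _]ger0_norm// -normrM.
  have -> : n%:R * (g 0 - fcoef g 0) =
    (halfint (fun u => g u * fejer n u) - n%:R * fcoef g 0)
    - (halfint (fun u => g u * fejer n u) - n%:R * g 0) by ring.
  by apply: le_trans (ler_normB _ _) _; exact: lerD.
have [n n0] : exists n : nat, L / (e / 2) < n%:R.
  by exists (Num.bound (L / (e / 2))); rewrite archi_boundP// divr_ge0// ltW.
have np : 0 < n%:R :> R by apply: le_lt_trans n0; rewrite divr_ge0// ltW.
have := main n; rewrite ltr_pdivrMr// in n0.
move=> mn; rewrite -(ler_pM2l np); apply: le_trans mn _; lra.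
Qed.

End FejerBound.

(** * Poisson summation for compactly supported windows *)

Section SegmentSupport.
Context {R : realType}.
Implicit Types (f : R -> R) (a b : R).

Lemma segint_support f a b c : 0 <= c -> a <= - c -> c <= b -> continuous f ->
  (forall y, c <= `|y| -> f y = 0) -> segint a b f = segint (- c) c f.
Proof.
move=> c0 ac cb cf f0; have cc : - c <= c by lra.
have z0 x y : (forall t, x <= t <= y -> c <= `|t|) -> segint x y f = 0.
  move=> H; transitivity (segint x y (fun=> 0 * 0)).
    by apply: segint_eq => t /H /f0 ->; rewrite mulr0.
  by rewrite segintZ ?mul0r//; cont.
rewrite (@segint_cat _ a (- c) b)//; last by lra.
rewrite (@segint_cat _ (- c) c b)//.
rewrite (z0 a (- c)) ?add0r; last first.
  move=> t /andP[_ tc]; rewrite -normrN; apply: le_trans (ler_norm _); lra.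
rewrite (z0 c b) ?addr0// => t /andP[ct _]; exact: le_trans ct (ler_norm _).
Qed.

Lemma segint_unit_cat f a n : continuous f ->
  \sum_(0 <= i < n) segint (a + i%:R) (a + i.+1%:R) f = segint a (a + n%:R) f.
Proof.
move=> cf; elim: n => [|n IH]; first by rewrite big_geq// addr0 segint_point.
rewrite big_nat_recr//= IH -segint_cat// ?lerDl// lerD2l ler_nat.
by [].
Qed.

End SegmentSupport.

Section Poisson.
Context {R : realType}.
Variables (W : R -> R) (rho : R).
Hypotheses (rho_ge0 : 0 <= rho) (cW : continuous W).
Hypotheses (WN : forall y, W (- y) = W y) (W0 : forall y, rho <= `|y| -> W y = 0).
Implicit Types (w xi t p q : R).

Definition cos_transform xi : R :=
  segint (- rho) rho (fun y => W y * cos (2 * pi * xi * y)).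

Local Notation A := cos_transform.

Lemma sum_I_even (V : zmodType) (F : int -> V) L :
  \sum_(l <- I_ (2 * L)) F l = \sum_(0 <= i < 2 * L) F (i%:Z - L%:Z).
Proof.
rewrite /I_ big_map /index_iota subn0; apply: eq_bigr => i _.
by rewrite mul2n doubleK.
Qed.

Lemma cos_int_shift (r i L : nat) u :
  cos (2 * pi * r%:R * (u + (i%:R - L%:R))) = cos (2 * pi * r%:R * u) :> R.
Proof.
have H n x : cos (x + 2 * pi * n%:R) = cos x :> R.
  elim: n => [|n IH]; first by rewrite mulr0 addr0.
  have -> : x + 2 * pi * n.+1%:R = (x + 2 * pi * n%:R) + pi *+ 2.
    by rewrite -(natr1 n) -mulr_natl; ring.
  by rewrite cosD2pi.
have -> : cos (2 * pi * r%:R * u) = cos (2 * pi * r%:R * u + 2 * pi * (r * i)%:R) :> R.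
  by rewrite H.
rewrite -(H (r * L)%N); congr cos; rewrite !natrM; ring.
Qed.

(** Expand the product of trigonometric functions; the parts that are odd in [y]
    integrate to zero because the window is even. *)
Lemma window_fourier w t p q (r : nat) :
  segint (- rho) rho (fun y => W y * (p * cos (2 * pi * w * y) + q * sin (2 * pi * w * y))
     * cos (2 * pi * r%:R * (y + t))) =
  (p * cos (2 * pi * r%:R * t) + q * sin (2 * pi * r%:R * t)) / 2 * A (w + r%:R) +
  (p * cos (2 * pi * r%:R * t) - q * sin (2 * pi * r%:R * t)) / 2 * A (w - r%:R).
Proof.
set C := cos (2 * pi * r%:R * t); set D := sin (2 * pi * r%:R * t).
pose O y := W y * (q * C * sin (2 * pi * w * y) * cos (2 * pi * r%:R * y)
  - p * D * cos (2 * pi * w * y) * sin (2 * pi * r%:R * y)).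
have cO : continuous O by rewrite /O; cont.
have O0 : segint (- rho) rho O = 0.
  by apply: segint_odd => // x; rewrite /O WN !mulrN !sinN !cosN; ring.
rewrite -[LHS]subr0 -O0 -segintB; [|by cont|by []].
rewrite /A -!segintZ; [|by cont..].
rewrite -segintD; [|by cont|by cont].
apply: segint_eq => y _; rewrite /O.
have -> : 2 * pi * r%:R * (y + t) = 2 * pi * r%:R * y + 2 * pi * r%:R * t by ring.
have -> : 2 * pi * (w + r%:R) * y = 2 * pi * w * y + 2 * pi * r%:R * y by ring.
have -> : 2 * pi * (w - r%:R) * y = 2 * pi * w * y - 2 * pi * r%:R * y by ring.
rewrite cosB !cosD -/C -/D.
move: (cos (2 * pi * w * y)) (sin (2 * pi * w * y)) (cos (2 * pi * r%:R * y)) (sin (2 * pi * r%:R * y)) => ca sa cb sb.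
by field.
Qed.

Let cauchy_schwarz1 p q a b : p ^+ 2 + q ^+ 2 = 1 -> a ^+ 2 + b ^+ 2 = 1 ->
  `|p * a + q * b| <= 1.
Proof.
move=> h1 h2; rewrite -[leRHS]normr1 -ler_sqr ?nnegrE// !real_normK ?num_real//.
rewrite expr1n -subr_ge0 (_ : 1 - _ = (p * b - q * a) ^+ 2) ?sqr_ge0//.
transitivity ((p ^+ 2 + q ^+ 2) * (a ^+ 2 + b ^+ 2) - (p * a + q * b) ^+ 2).
  by rewrite h1 h2 mulr1.
by ring.
Qed.

(** The [1]-periodic function [F], the sum of the integer translates of the
    modulated window [G], has mean [p A w] and its other Fourier coefficients
    are given by [window_fourier]. The bound [|t| <= L - rho] makes the listed
    nodes cover the support. Replacing a complex modulus by all real directions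
    [(p, q)] keeps the Fourier analysis real. *)
Lemma poisson_real L w t p q (T : R) : `|t| <= L%:R - rho ->
  p ^+ 2 + q ^+ 2 = 1 ->
  (forall n, \sum_(1 <= r < n.+1) (`|A (w + r%:R)| + `|A (w - r%:R)|) <= T) ->
  p * (\sum_(l <- I_ (2 * L)) W (l%:~R - t) * cos (2 * pi * w * (l%:~R - t)) - A w)
  + q * (\sum_(l <- I_ (2 * L)) W (l%:~R - t) * sin (2 * pi * w * (l%:~R - t))) <= T.
Proof.
move=> tL pq HT; move: (tL); rewrite ler_norml => /andP[tL1 tL2].
pose G y := W y * (p * cos (2 * pi * w * y) + q * sin (2 * pi * w * y)).
have cG : continuous G by rewrite /G; cont.
have G0 y : rho <= `|y| -> G y = 0 by move=> /W0; rewrite /G => ->; rewrite mul0r.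
have eL : L.+1%:R = L%:R + 1 :> R by rewrite -natr1.
(* One node is added at each end, where [W] vanishes, so that the unit
   intervals centred at the nodes cover the whole support. *)
pose s (i : nat) : R := i%:R - (L%:R + 1) - t.
pose F u := \sum_(0 <= i < 2 * L.+1) G (u + s i).
have cF : continuous F by rewrite /F; cont.
have FE r : fcoef F r = segint (- rho) rho (fun y => G y * cos (2 * pi * r%:R * (y + t))).
  pose H y := G y * cos (2 * pi * r%:R * (y + t)).
  have cH : continuous H by rewrite /H; cont.
  transitivity (\sum_(0 <= i < 2 * L.+1) segint (- (1 / 2)) (1 / 2) (fun u => H (u + s i))).
    rewrite -segint_sum; last by move=> i; cont.
    apply: segint_eq => u _; rewrite /F mulr_suml; apply: eq_bigr => i _.
    by rewrite /H -addrA /s subrK -eL cos_int_shift.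
  transitivity (segint (- (1 / 2) + s 0%N) (- (1 / 2) + s 0%N + (2 * L.+1)%:R) H).
    rewrite -segint_unit_cat//; apply: eq_bigr => i _; rewrite segint_shift//; last by lra.
    have -> : - (1 / 2) + s 0%N + i%:R = - (1 / 2) + s i by rewrite /s; ring.
    have -> : - (1 / 2) + s 0%N + i.+1%:R = 1 / 2 + s i by rewrite /s -(natr1 i); field.
    by [].
  apply: segint_support => //.
  - by rewrite /s; lra.
  - by rewrite /s natrM eL; lra.
  - by move=> y /G0 h; rewrite /H h mul0r.
have F0 : F 0 = p * (\sum_(l <- I_ (2 * L)) W (l%:~R - t) * cos (2 * pi * w * (l%:~R - t)))
  + q * (\sum_(l <- I_ (2 * L)) W (l%:~R - t) * sin (2 * pi * w * (l%:~R - t))).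
  rewrite !mulr_sumr -big_split/= sum_I_even /F.
  have -> : (2 * L.+1 = (2 * L).+2)%N by rewrite !mul2n doubleS.
  rewrite big_nat_recr//= big_nat_recl//=.
  rewrite [X in X + _ + _]G0; last first.
    by rewrite add0r /s -normrN; apply: le_trans (ler_norm _); lra.
  rewrite [X in _ + X]G0; last first.
    rewrite add0r /s; apply: le_trans (ler_norm _).
    by rewrite -(natr1 (2 * L)) natrM; lra.
  rewrite add0r addr0; apply: eq_bigr => i _.
  have -> : 0 + s i.+1 = (i%:Z - L%:Z)%:~R - t.
    by rewrite /s intrB -!pmulrn -(natr1 i); ring.
  by rewrite /G; ring.
have mean : fcoef F 0 = p * A w.
  rewrite FE window_fourier (_ : 2 * pi * 0%:R * t = 0); last by rewrite mulr0 mul0r.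
  by rewrite cos0 sin0 addr0 subr0; field.
have -> : forall x y, p * (x - A w) + q * y = p * x + q * y - p * A w.
  by move=> x y; ring.
rewrite -F0 -mean; apply: le_trans (ler_norm _) _.
apply: fourier_dist_mean => // n; apply: le_trans (HT n); apply: ler_sum => r _.
rewrite FE window_fourier; set C := cos _; set D := sin _.
have CD : C ^+ 2 + D ^+ 2 = 1 by exact: cos2Dsin2.
have CD' : C ^+ 2 + (- D) ^+ 2 = 1 by rewrite sqrrN.
have h1 := cauchy_schwarz1 pq CD; have h2 := cauchy_schwarz1 pq CD'.
have -> : 2 * ((p * C + q * D) / 2 * A (w + r%:R) + (p * C - q * D) / 2 * A (w - r%:R))
  = (p * C + q * D) * A (w + r%:R) + (p * C + q * - D) * A (w - r%:R) by field.
apply: le_trans (ler_normD _ _) _; rewrite !normrM.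
by apply: lerD; rewrite ler_piMl.
Qed.

End Poisson.

Local Open Scope complex_scope.

(** * Quadrature with the window *)

Section ComplexModulus.
Context {R : realType}.
Implicit Types (x y a b t : R) (z : R[i]).

Lemma expiD a b : expi (a + b) = expi a * expi b :> R[i].
Proof.
rewrite /expi cosD sinD; apply/eqP; rewrite eq_complex /=.
by rewrite eqxx andTb; apply/eqP; ring.
Qed.

Lemma cabs_expi a : cabs (expi a) = 1 :> R.
Proof. by rewrite /cabs /expi /= cos2Dsin2 sqrtr1. Qed.

Lemma cabsM z1 z2 : cabs (z1 * z2) = cabs z1 * cabs z2 :> R.
Proof. exact: ComplexField.Normc.normcM. Qed.

Lemma cabsD z1 z2 : cabs (z1 + z2) <= cabs z1 + cabs z2 :> R.
Proof. exact: le_normcD. Qed.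

Lemma cabsN z : cabs (- z) = cabs z :> R.
Proof. exact: normcN. Qed.

Lemma cabs_real x : cabs (x%:C) = `|x|.
Proof. by rewrite /cabs /= expr0n addr0 sqrtr_sqr. Qed.

Lemma cabs_ge0 z : 0 <= cabs z :> R.
Proof. by case: z => a b; exact: sqrtr_ge0. Qed.

Lemma cabs0 : cabs 0 = 0 :> R.
Proof. exact: ComplexField.Normc.normc0. Qed.

Lemma cabs_sum (I : Type) (s : seq I) (F : I -> R[i]) :
  cabs (\sum_(i <- s) F i) <= \sum_(i <- s) cabs (F i).
Proof.
elim: s => [|i s IH]; first by rewrite !big_nil cabs0.
by rewrite !big_cons; apply: le_trans (cabsD _ _) _; rewrite lerD2l.
Qed.

Lemma sum_complex (I : Type) (s : seq I) (a b : I -> R) :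
  \sum_(i <- s) (a i +i* b i) = (\sum_(i <- s) a i) +i* (\sum_(i <- s) b i).
Proof.
elim: s => [|i s IH]; first by rewrite !big_nil.
by rewrite !big_cons IH.
Qed.

Lemma sqrt_le_of_directions x y t :
  (forall p q, p ^+ 2 + q ^+ 2 = 1 -> p * x + q * y <= t) ->
  Num.sqrt (x ^+ 2 + y ^+ 2) <= t.
Proof.
move=> H; set n := Num.sqrt _.
have n2 : n ^+ 2 = x ^+ 2 + y ^+ 2 by rewrite sqr_sqrtr// addr_ge0 ?sqr_ge0.
have [n0|n0] := eqVneq n 0.
  have x0 : x = 0.
    apply/eqP; rewrite -sqrf_eq0 eq_le sqr_ge0 andbT.
    by have := sqr_ge0 y; move: n2; rewrite n0 expr0n /=; lra.
  have := H 1 0; rewrite x0 mulr0 mul0r addr0 n0; apply.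
  by rewrite expr1n expr0n addr0.
have -> : n = x / n * x + y / n * y.
  have -> : x / n * x + y / n * y = (x ^+ 2 + y ^+ 2) / n by field.
  by rewrite -n2; field.
apply: H; have -> : (x / n) ^+ 2 + (y / n) ^+ 2 = (x ^+ 2 + y ^+ 2) / n ^+ 2 by field.
by rewrite -n2 divff// sqrf_eq0.
Qed.

End ComplexModulus.

Section Quadrature.
Context {R : realType}.
Variables (m : nat) (sigma : R).
Hypotheses (m2 : (2 <= m)%N) (sigma_bnd : 5 / 4 <= sigma <= 2).
Implicit Types (w t : R).

Definition alias_eps : R := (24 * m%:R `^ (3 / 2) + 10) *
  expR (- (2 * pi * m%:R * Num.sqrt (1 - 1 / sigma))).

Let m_gt0 : 0 < m%:R :> R. Proof. by rewrite ltr0n ltnW. Qed.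

(** Factoring out the unimodular number [expi (- 2 pi w t)] leaves the complex
    number whose components are estimated by [poisson_real]. *)
Lemma window_quadrature L w t : `|t| <= L%:R - m%:R ->
  - (1 / (2 * sigma)) <= w <= 1 / (2 * sigma) ->
  cabs (\sum_(l <- I_ (2 * L)) (omega_sinh m sigma ((l%:~R - t) / m%:R))%:C
          * expi (- (2 * pi * w * l%:~R))
        - (wft m sigma w)%:C * expi (- (2 * pi * w * t)))
  <= alias_eps * wft m sigma w.
Proof.
move=> tL wd; pose W y := omega_sinh m sigma (y / m%:R).
have co := @omega_sinh_cont R m sigma.
have cW : continuous W by rewrite /W; cont.
have WN y : W (- y) = W y by rewrite /W mulNr omega_sinhN.
have W0 y : m%:R <= `|y| -> W y = 0.
  move=> ym; apply: omega_sinh_eq0.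
  by rewrite normrM normfV (ger0_norm (ltW m_gt0)) ler_pdivlMr// mul1r.
have HT n := wft_aliasing m2 sigma_bnd n wd.
set X := \sum_(l <- I_ (2 * L)) W (l%:~R - t) * cos (2 * pi * w * (l%:~R - t)) - wft m sigma w.
set Y := \sum_(l <- I_ (2 * L)) W (l%:~R - t) * sin (2 * pi * w * (l%:~R - t)).
have -> : \sum_(l <- I_ (2 * L)) (omega_sinh m sigma ((l%:~R - t) / m%:R))%:C
          * expi (- (2 * pi * w * l%:~R)) - (wft m sigma w)%:C * expi (- (2 * pi * w * t))
   = expi (- (2 * pi * w * t)) * (X +i* (- Y)).
  have -> : X +i* (- Y) = \sum_(l <- I_ (2 * L)) (W (l%:~R - t))%:C
      * expi (- (2 * pi * w * (l%:~R - t))) - (wft m sigma w)%:C.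
    rewrite (eq_bigr (fun l : int => (W (l%:~R - t) * cos (2 * pi * w * (l%:~R - t)))
      +i* (- (W (l%:~R - t) * sin (2 * pi * w * (l%:~R - t)))))); last first.
      move=> l _; rewrite /expi cosN sinN; apply/eqP; rewrite eq_complex /=.
      by apply/andP; split; apply/eqP; ring.
    rewrite sum_complex sumrN; apply/eqP; rewrite eq_complex /=.
    by rewrite oppr0 addr0 !eqxx.
  rewrite mulrBr [X in _ - X]mulrC mulr_sumr; congr (_ - _); apply: eq_bigr => l _.
  rewrite mulrCA -expiD; congr (_ * expi _); ring.
rewrite cabsM cabs_expi mul1r /cabs /= sqrrN.
apply: sqrt_le_of_directions => p q pq.
exact: (poisson_real (ltW m_gt0) cW WN W0 tL pq HT).
Qed.

(** Only nodes at distance less than [m] from [t] contribute, and the window is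
    at most [1]. The bound is independent of the number of nodes. *)
Lemma window_sum_le L t :
  \sum_(l <- I_ L) omega_sinh m sigma ((l%:~R - t) / m%:R) <= 2 * m%:R + 1.
Proof.
pose c := Num.floor t.
pose J := [seq (c - m%:Z + i%:Z)%R | i <- iota 0 (2 * m).+1].
have H l : omega_sinh m sigma ((l%:~R - t) / m%:R) <= (if l \in J then 1 else 0 : R).
  case: ifPn => [_|lJ].
    by have /andP[] := omega_sinh_ge0_le1 m2 sigma_bnd ((l%:~R - t) / m%:R).
  rewrite omega_sinh_eq0// normrM normfV (ger0_norm (ltW m_gt0)).
  rewrite ler_pdivlMr// mul1r leNgt; apply: contra lJ.
  rewrite ltr_norml => /andP[h1 h2].
  have /andP[c1 c2] := floor_itv t.
  have l1 : (c - m%:Z)%:~R < l%:~R :> R by rewrite intrB -pmulrn; lra.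
  have l2 : l%:~R < (c + 1 + m%:Z)%:~R :> R by rewrite intrD -pmulrn; lra.
  rewrite !ltr_int in l1 l2.
  apply/mapP; exists (absz (l - (c - m%:Z))%R); last by lia.
  by rewrite mem_iota; lia.
apply: le_trans (ler_sum _ (fun l _ => H l)) _.
rewrite -big_mkcond/= -big_filter big_const_seq count_predT iter_addr addr0.
apply: (@le_trans _ _ ((2 * m).+1%:R)); last by rewrite -natr1 natrM.
rewrite ler_nat; apply: leq_trans (_ : size J <= _)%N; last by rewrite size_map size_iota.
apply: uniq_leq_size; last by move=> l; rewrite mem_filter => /andP[].
apply: filter_uniq; rewrite map_inj_uniq ?iota_uniq// => i j /=; lia.
Qed.

End Quadrature.

(** * The two approximation steps *)

Section Hat.
Context {R : realType}.
Implicit Types (phi W : R -> R) (c v x : R).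

Lemma Rintegral_setT f c : (forall y, c <= `|y| -> f y = 0 :> R) ->
  \int[@lebesgue_measure R]_(y in setT) f y = segint (- c) c f.
Proof.
move=> f0; rewrite /segint [RHS]Rintegral_mkcond; apply: eq_Rintegral => y _.
rewrite patchE; case: ifPn => //; rewrite notin_setE /= in_itv/= -ler_norml => /negP.
by rewrite -ltNge => /ltW /f0.
Qed.

Lemma hat_cos_transform phi c v : 0 <= c -> continuous phi ->
  (forall y, phi (- y) = phi y) -> (forall y, c <= `|y| -> phi y = 0) ->
  hat phi v = (cos_transform phi c v)%:C.
Proof.
move=> c0 cphi phiN phi0; rewrite /hat /fourier /Cintegral.
have -> : (fun x => complex.Re ((phi x)%:C * expi (- (2 * pi * v * x)))) =
    fun x => phi x * cos (2 * pi * v * x).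
  by apply/funext => x; rewrite /expi /= cosN; ring.
have -> : (fun x => complex.Im ((phi x)%:C * expi (- (2 * pi * v * x)))) =
    fun x => - (phi x * sin (2 * pi * v * x)).
  by apply/funext => x; rewrite /expi /= sinN; ring.
rewrite (@Rintegral_setT _ c); last by move=> y /phi0 ->; rewrite mul0r.
rewrite (@Rintegral_setT _ c); last by move=> y /phi0 ->; rewrite mul0r oppr0.
have cs : continuous (fun x => phi x * sin (2 * pi * v * x)) by cont.
have s0 : segint (- c) c (fun x => phi x * sin (2 * pi * v * x)) = 0.
  by apply: segint_odd => // x; rewrite phiN mulrN sinN mulrN.
by rewrite segintN// s0 oppr0.
Qed.

Lemma hat_phi_sinh (N m : nat) (sigma v : R) : (0 < N)%N -> (0 < m)%N ->
  hat (phi_sinh N m sigma) v = (wft m sigma (v / N%:R) / N%:R)%:C.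
Proof.
move=> N0 m0; have NR : 0 < N%:R :> R by rewrite ltr0n.
have mR : 0 < m%:R :> R by rewrite ltr0n.
have co := @omega_sinh_cont R m sigma.
have cphi : continuous (phi_sinh N m sigma) by rewrite /phi_sinh; cont.
rewrite (@hat_cos_transform _ (m%:R / N%:R))//.
- congr (_%:C); rewrite /cos_transform [_ / N%:R in LHS]mulrC -mulrN.
  rewrite segint_scale ?invr_gt0//; [|by lra|by cont].
  rewrite mulrC; congr (_ / _); apply: segint_eq => y _.
  by rewrite /phi_sinh mulVKf ?gt_eqF//; congr (_ * cos _); ring.
- by move=> y; rewrite /phi_sinh mulrN mulNr omega_sinhN.
- move=> y; rewrite ler_pdivrMr// => h; rewrite /phi_sinh omega_sinh_eq0//.
  by rewrite normrM normfV normrM (gtr0_norm NR) (gtr0_norm mR) ler_pdivlMr// mul1r mulrC.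
Qed.

(** Dominated convergence, with [|W|] as majorant. *)
Lemma cos_transform_cont W (rho : R) : continuous W -> continuous (cos_transform W rho).
Proof.
move=> cW x.
have cabsW : continuous (fun y => `|W y|).
  by move=> y; apply: (cvg_comp _ _ (cW y)); exact: norm_continuous.
have H := @continuity_under_integral R _ _ (@lebesgue_measure R)
  (fun l y => W y * cos (2 * pi * l * y)) _ (measurable_itv `[- rho, rho]) (x - 1) (x + 1).
have int_f l : [set` `]x - 1, x + 1[] l -> (@lebesgue_measure R).-integrable
    `[- rho, rho] (EFin \o (fun y => W y * cos (2 * pi * l * y))).
  by move=> _; apply: seg_integrable; cont.
have cf : {ae @lebesgue_measure R, forall y, [set` `[- rho, rho]] y ->
    {in [set` `]x - 1, x + 1[], continuous (fun l => W y * cos (2 * pi * l * y))}}.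
  apply: aeW => y _ l _.
  have : continuous (fun l => W y * cos (2 * pi * l * y)) by cont.
  exact.
have int_g : (@lebesgue_measure R).-integrable `[- rho, rho] (EFin \o (fun y => `|W y|)).
  exact: seg_integrable.
have ub l : [set` `]x - 1, x + 1[] l -> {ae @lebesgue_measure R, forall y,
    [set` `[- rho, rho]] y -> `|W y * cos (2 * pi * l * y)| <= `|W y|}.
  move=> _; apply: aeW => y _; rewrite normrM ler_piMr//.
  by rewrite ler_norml cos_geN1 cos_le1.
apply: (H int_f cf _ int_g ub x); rewrite inE /= in_itv/=; apply/andP; split; lra.
Qed.

Lemma wft_cont m (sigma : R) : continuous (wft m sigma).
Proof.
apply: (@cos_transform_cont (fun y => omega_sinh m sigma (y / m%:R))).
by have co := @omega_sinh_cont R m sigma; cont.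
Qed.

End Hat.

Section Assembly.
Context {R : realType}.

Lemma mem_I_even L (l : int) : l \in I_ (2 * L) -> `|l%:~R| <= L%:R :> R.
Proof.
rewrite /I_ => lI; have [i iI ->] := mapP lI; move: iI; rewrite mem_iota add0n => /andP[_ iL].
rewrite mul2n doubleK intrB -!pmulrn ler_norml.
have iL' : i%:R <= L%:R + L%:R :> R by rewrite -natrD ler_nat addnn -mul2n ltnW.
have i0 : 0 <= i%:R :> R by [].
by apply/andP; split; lra.
Qed.

Lemma nnfft_s1NE (phi1 phi2 : R -> R) (N1 N2 m1 M1 : nat) (sigma1 : R)
    (f : int -> R[i]) (v : int -> R) x :
  nnfft_s1N phi1 phi2 N1 N2 m1 M1 sigma1 f v x =
  \sum_(l <- I_ (N1 + 2 * m1)) nnfft_g phi1 N1 M1 f v l *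
    ((hat phi2 l%:~R)^-1 * (N2%:R^-1 * \sum_(s <- I_ N2)
      (phi2 (x / sigma1 - s%:~R / N2%:R))%:C * expi (- (2 * pi * l%:~R * s%:~R / N2%:R)))).
Proof.
rewrite /nnfft_s1N /nnfft_h.
under eq_bigr => s _ do rewrite mulr_sumr mulr_suml.
rewrite exchange_big; apply: eq_bigr => l _.
rewrite !mulr_sumr; apply: eq_bigr => s _.
by ring.
Qed.

Variables (N N1 N2 m1 m2 M1 : nat) (sigma1 sigma2 : R).
Hypotheses (N_gt0 : (0 < N)%N) (N1_gt0 : (0 < N1)%N) (N1_even : ~~ odd N1)
  (N1E : N1%:R = sigma1 * N%:R) (sigma1_bnd : 5 / 4 <= sigma1 <= 2)
  (m1_gt1 : (2 <= m1)%N) (m1_N1 : (2 * m1 < N1)%N)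
  (N2_gt0 : (0 < N2)%N) (N2_even : ~~ odd N2)
  (N2E : N2%:R = sigma2 * (N1 + 2 * m1)%:R) (sigma2_bnd : 5 / 4 <= sigma2 <= 2)
  (m2_gt1 : (2 <= m2)%N) (m2_N2 : (2 * m2)%:R <= (1 - 1 / sigma1) * N2%:R).
Variables (f : int -> R[i]) (v : int -> R).
Hypothesis v_bnd : forall k, k \in I_ M1 -> `|v k| <= 1 / 2.

Let phi1 := phi_sinh N1 m1 sigma1.
Let phi2 := phi_sinh N2 m2 sigma2.
Let A1 w := wft m1 sigma1 w.
Let eps1 := alias_eps m1 sigma1.
Let eps2 := alias_eps m2 sigma2.

Let N1R : 0 < N1%:R :> R. Proof. by rewrite ltr0n. Qed.
Let N2R : 0 < N2%:R :> R. Proof. by rewrite ltr0n. Qed.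
Let m1R : 0 < m1%:R :> R. Proof. by rewrite ltr0n ltnW. Qed.
Let m2R : 0 < m2%:R :> R. Proof. by rewrite ltr0n ltnW. Qed.
Let sigma1_gt0 : 0 < sigma1. Proof. by case/andP: sigma1_bnd => h _; lra. Qed.
Let sigma2_gt0 : 0 < sigma2. Proof. by case/andP: sigma2_bnd => h _; lra. Qed.

Let IE1 : (N1 + 2 * m1 = 2 * (N1./2 + m1))%N.
Proof. by rewrite mulnDr [(2 * N1./2)%N]mul2n even_halfK. Qed.

Let IE2 : (N2 = 2 * N2./2)%N.
Proof. by rewrite mul2n even_halfK. Qed.

(** The condition [2 m2 <= (1 - 1 / sigma1) N2] places the window centred at
    [N2 x / sigma1] inside the range of the nodes [s]. *)
Let second_step (x : R) (l : int) : - (1 / 2) <= x <= 1 / 2 -> l \in I_ (N1 + 2 * m1) ->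
  cabs ((hat phi2 l%:~R)^-1 * (N2%:R^-1 * \sum_(s <- I_ N2)
      (phi2 (x / sigma1 - s%:~R / N2%:R))%:C * expi (- (2 * pi * l%:~R * s%:~R / N2%:R)))
    - expi (- (2 * pi * (x / sigma1) * l%:~R))) <= eps2.
Proof.
move=> xb lI; set w := l%:~R / N2%:R : R; set t := N2%:R * (x / sigma1).
have half2 : N2%:R = 2 * (N2./2)%:R :> R by rewrite -natrM -IE2.
have wb : - (1 / (2 * sigma2)) <= w <= 1 / (2 * sigma2).
  move: lI; rewrite IE1 => /mem_I_even; rewrite -ler_norml /w normrM normfV (gtr0_norm N2R).
  rewrite ler_pdivrMr// N2E IE1 natrM; move: (_%:R) => L lL.
  by rewrite (_ : 1 / (2 * sigma2) * (sigma2 * (2 * L)) = L)//; field; rewrite gt_eqF.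
have tb : `|t| <= (N2./2)%:R - m2%:R.
  have : N2%:R * (1 - 1 / sigma1) / 2 >= m2%:R by move: m2_N2; rewrite natrM mulrC; lra.
  have xn : `|x| <= 1 / 2 by rewrite ler_norml.
  have : `|t| <= N2%:R * (1 / 2 / sigma1).
    rewrite /t !normrM normfV (gtr0_norm N2R) (gtr0_norm sigma1_gt0) ler_pM2l//.
    by rewrite ler_wpM2r// invr_ge0 ltW.
  have -> : N2%:R * (1 / 2 / sigma1) = N2%:R / 2 - N2%:R * (1 - 1 / sigma1) / 2.
    by field; rewrite gt_eqF.
  by rewrite half2; move: (_ * (1 - _)) => Z; lra.
have A0 := wft_gt0 m2_gt1 sigma2_bnd wb.
have := window_quadrature m2_gt1 sigma2_bnd tb wb; rewrite -IE2 -/eps2.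
set B := \sum_(s <- _) _; set B' := \sum_(s <- _) _.
have -> : B' = B.
  rewrite /B /B'; apply: eq_bigr => s _; congr (_%:C * expi _).
    rewrite /phi2 /phi_sinh -[RHS]omega_sinhN; congr (omega_sinh _ _ _).
    by rewrite /t; field; rewrite !gt_eqF.
  by rewrite /w; ring.
rewrite (hat_phi_sinh sigma2 _ N2_gt0 (ltnW m2_gt1)) -/w.
have -> : 2 * pi * w * t = 2 * pi * (x / sigma1) * l%:~R.
  by rewrite /w /t; field; rewrite !gt_eqF.
move=> HB.
have A0C : (wft m2 sigma2 w)%:C != 0 :> R[i] by rewrite eq_complex/= gt_eqF.
have -> : ((wft m2 sigma2 w / N2%:R)%:C)^-1 * (N2%:R^-1 * B) - expi (- (2 * pi * (x / sigma1) * l%:~R))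
  = ((wft m2 sigma2 w)^-1)%:C * (B - (wft m2 sigma2 w)%:C * expi (- (2 * pi * (x / sigma1) * l%:~R))).
  have NC : (N2%:R : R[i]) != 0 by rewrite pnatr_eq0 -lt0n.
  rewrite rmorphM !fmorphV rmorph_nat.
  by field; rewrite NC A0C.
rewrite cabsM cabs_real ger0_norm ?invr_ge0 ?(ltW A0)//.
by rewrite mulrC ler_pdivrMr.
Qed.

(** The extra [2 m1] nodes [l] make room for the window centred at [N1 v_k],
    since [|v_k| <= 1 / 2]. *)
Let first_step (x : R) (k : int) : - (1 / 2) <= x <= 1 / 2 -> k \in I_ M1 ->
  cabs (\sum_(l <- I_ (N1 + 2 * m1)) (phi1 (l%:~R / N1%:R - v k))%:C
          * expi (- (2 * pi * (x / sigma1) * l%:~R))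
        - (A1 (x / sigma1))%:C * expi (- (2 * pi * N%:R * v k * x)))
  <= eps1 * A1 (x / sigma1).
Proof.
move=> xb kI; set w := x / sigma1; set t := N1%:R * v k.
have half1 : N1%:R = 2 * (N1./2)%:R :> R by rewrite -natrM mul2n even_halfK.
have wb : - (1 / (2 * sigma1)) <= w <= 1 / (2 * sigma1).
  rewrite -ler_norml /w normrM normfV (gtr0_norm sigma1_gt0) ler_pdivrMr//.
  have xn : `|x| <= 1 / 2 by rewrite ler_norml.
  by rewrite (_ : 1 / (2 * sigma1) * sigma1 = 1 / 2)//; field; rewrite gt_eqF.
have tb : `|t| <= (N1./2 + m1)%:R - m1%:R.
  rewrite natrD addrK /t normrM (gtr0_norm N1R).
  apply: le_trans (ler_wpM2l (ltW N1R) (v_bnd kI)) _; rewrite half1; lra.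
have := window_quadrature m1_gt1 sigma1_bnd tb wb; rewrite -IE1.
rewrite (_ : 2 * pi * w * t = 2 * pi * N%:R * v k * x); last first.
  by rewrite /w /t N1E; field; rewrite gt_eqF.
set B := \sum_(s <- _) _; set B' := \sum_(s <- _) _.
suff -> : B' = B by [].
apply: eq_bigr => l _; congr (_%:C * _); rewrite /phi1 /phi_sinh.
by congr (omega_sinh _ _ _); rewrite /t; field; rewrite !gt_eqF.
Qed.

Let g := nnfft_g phi1 N1 M1 f v.

Let sum_g_le : \sum_(l <- I_ (N1 + 2 * m1)) cabs (g l) <=
  N1%:R^-1 * ((2 * m1%:R + 1) * \sum_(k <- I_ M1) cabs (f k)).
Proof.
have H l : cabs (g l) <= \sum_(k <- I_ M1) N1%:R^-1 * (cabs (f k) *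
    omega_sinh m1 sigma1 ((l%:~R - N1%:R * v k) / m1%:R)).
  rewrite /g /nnfft_g cabsM -mulr_sumr.
  have -> : cabs (N1%:R^-1 : R[i]) = (N1%:R : R)^-1.
    have -> : (N1%:R^-1 : R[i]) = ((N1%:R : R)^-1)%:C by rewrite fmorphV rmorph_nat.
    by rewrite cabs_real ger0_norm// invr_ge0.
  rewrite ler_wpM2l ?invr_ge0//; apply: le_trans (cabs_sum _ _) _; apply: ler_sum => k _.
  rewrite cabsM cabs_real ler_wpM2l ?cabs_ge0//.
  have /andP[w0 _] := omega_sinh_ge0_le1 m1_gt1 sigma1_bnd ((l%:~R - N1%:R * v k) / m1%:R).
  rewrite /phi1 /phi_sinh (_ : _ / m1%:R = (l%:~R - N1%:R * v k) / m1%:R).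
    by rewrite ger0_norm.
  by field; rewrite !gt_eqF.
apply: le_trans (ler_sum _ (fun l _ => H l)) _.
rewrite exchange_big /= mulr_sumr mulr_sumr; apply: ler_sum => k _.
rewrite -!mulr_sumr ler_wpM2l ?invr_ge0// mulrC ler_wpM2r ?cabs_ge0//.
exact: window_sum_le.
Qed.

(** The second approximation error enters divided by [A1], which is at least
    [sqrt m1 * exp (s0 - beta)]. Since [N1 >= 2 m1 + 1] and
    [sqrt (2 pi m1) <= 3 sqrt m1], the number [2 m1 + 1] of active nodes is
    absorbed by [2 N1 + 4 m1]. *)
Let step_factor x : - (1 / 2) <= x <= 1 / 2 ->
  (2 * m1%:R + 1) / A1 (x / sigma1) <=
  (2 * N1%:R + 4 * m1%:R) / Num.sqrt (2 * m1%:R * pi) *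
   expR (2 * pi * m1%:R * (1 - Num.sqrt (1 - 1 / sigma1) - 1 / (2 * sigma1))).
Proof.
move=> xb; set w := x / sigma1.
have wb : - (1 / (2 * sigma1)) <= w <= 1 / (2 * sigma1).
  rewrite -ler_norml /w normrM normfV (gtr0_norm sigma1_gt0) ler_pdivrMr//.
  have xn : `|x| <= 1 / 2 by rewrite ler_norml.
  by rewrite (_ : 1 / (2 * sigma1) * sigma1 = 1 / 2)//; field; rewrite gt_eqF.
have H := wft_ge m1_gt1 sigma1_bnd wb; have A0 := wft_gt0 m1_gt1 sigma1_bnd wb.
set y := 2 * pi * m1%:R * (1 - _ - _).
have yE : 2 * pi * m1%:R * Num.sqrt (1 - 1 / sigma1) - beta m1 sigma1 = - y.
  by rewrite /y /beta; ring.
rewrite yE in H.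
have M0 : 0 < Num.sqrt (m1%:R : R) by rewrite sqrtr_gt0.
have e0 := expR_gt0 y.
have s0 : 0 < Num.sqrt (2 * m1%:R * pi : R) by rewrite sqrtr_gt0 !mulr_gt0 ?pi_gt0.
have s3 : Num.sqrt (2 * m1%:R * pi) <= 3 * Num.sqrt (m1%:R : R).
  have -> : 3 = Num.sqrt (3 ^+ 2) :> R by rewrite sqrtr_sqr ger0_norm.
  rewrite -sqrtrM ?sqr_ge0// ler_wsqrtr//.
  have /andP[_ p3] := @pi_bounds R; have := ler_wpM2l (ltW m1R) p3; have := m1R; lra.
rewrite ler_pdivrMr//.
apply: (@le_trans _ _ ((2 * N1%:R + 4 * m1%:R) / Num.sqrt (2 * m1%:R * pi) * Num.sqrt m1%:R)).
  rewrite mulrAC ler_pdivlMr//.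
  have n1 : 2 * m1%:R + 1 <= N1%:R :> R by rewrite -natrM natr1 ler_nat.
  apply: le_trans (_ : (2 * m1%:R + 1) * (3 * Num.sqrt m1%:R) <= _).
    by rewrite ler_wpM2l//; lra.
  have m12 : 2 <= m1%:R :> R by rewrite (ler_nat R 2).
  by rewrite mulrA ler_wpM2r ?(ltW M0)//; lra.
have E : expR y * expR (- y) = 1 by rewrite -expRD subrr expR0.
have K0 : 0 <= (2 * N1%:R + 4 * m1%:R) / Num.sqrt (2 * m1%:R * pi) :> R.
  by rewrite divr_ge0 ?(ltW s0)// addr_ge0// mulr_ge0.
rewrite -[X in _ <= X]mulrA; apply: ler_wpM2l => //.
apply: le_trans (ler_wpM2l (ltW e0) H).
by rewrite mulrCA E mulr1.
Qed.

(** With [Q k] the first quadrature sum for the frequency [v k] and [q l] the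
    second one divided by its transform, the error is exactly the sum of a
    first-step part, linear in the defects of the [Q k], and a second-step part,
    linear in the defects of the [q l]. *)
Lemma nnfft_error_le x : - (1 / 2) <= x <= 1 / 2 ->
  nnfft_error phi1 phi2 N N1 N2 m1 M1 sigma1 f v x <=
  E_sinh N1 m1 m2 sigma1 sigma2 * \sum_(k <- I_ M1) cabs (f k).
Proof.
move=> xb; set w := x / sigma1; set Sf := \sum_(k <- _) _.
have wb : - (1 / (2 * sigma1)) <= w <= 1 / (2 * sigma1).
  rewrite -ler_norml /w normrM normfV (gtr0_norm sigma1_gt0) ler_pdivrMr//.
  have xn : `|x| <= 1 / 2 by rewrite ler_norml.
  by rewrite (_ : 1 / (2 * sigma1) * sigma1 = 1 / 2)//; field; rewrite gt_eqF.
have A0 := wft_gt0 m1_gt1 sigma1_bnd wb; rewrite -/(A1 w) in A0.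
have A0C : (A1 w)%:C != 0 :> R[i] by rewrite eq_complex/= gt_eqF.
have NC : (N1%:R : R[i]) != 0 by rewrite pnatr_eq0 -lt0n.
have hatE : hat phi1 (N%:R * x) = (A1 w)%:C / N1%:R.
  rewrite (hat_phi_sinh sigma1 _ N1_gt0 (ltnW m1_gt1)) rmorphM fmorphV rmorph_nat /A1.
  congr ((wft _ _ _)%:C / _); rewrite N1E /w; field.
  by rewrite !gt_eqF// ltr0n.
pose e (l : int) : R[i] := expi (- (2 * pi * w * l%:~R)).
pose q (l : int) : R[i] := (hat phi2 l%:~R)^-1 * (N2%:R^-1 * \sum_(s <- I_ N2)
      (phi2 (x / sigma1 - s%:~R / N2%:R))%:C * expi (- (2 * pi * l%:~R * s%:~R / N2%:R))).
pose Q (k : int) : R[i] := \sum_(l <- I_ (N1 + 2 * m1)) (phi1 (l%:~R / N1%:R - v k))%:C * e l.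
have Hq l : l \in I_ (N1 + 2 * m1) -> cabs (q l - e l) <= eps2 by exact: second_step.
have HQ k : k \in I_ M1 -> cabs (Q k - (A1 w)%:C * expi (- (2 * pi * N%:R * v k * x)))
    <= eps1 * A1 w by exact: first_step.
have sE : nnfft_s1N phi1 phi2 N1 N2 m1 M1 sigma1 f v x =
    N1%:R^-1 * (\sum_(k <- I_ M1) f k * Q k)
    + \sum_(l <- I_ (N1 + 2 * m1)) g l * (q l - e l).
  rewrite nnfft_s1NE -/g.
  rewrite (eq_bigr (fun l => g l * e l + g l * (q l - e l))); last first.
    by move=> l _; rewrite -mulrDr addrC subrK.
  rewrite big_split /=; congr (_ + _).
  rewrite /g /nnfft_g.
  under eq_bigr => l _ do rewrite -mulrA mulr_suml.
  rewrite -mulr_sumr exchange_big /=; congr (_ * _); apply: eq_bigr => k _.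
  by rewrite /Q mulr_sumr; apply: eq_bigr => l _; rewrite mulrA.
have errE : exp_sum N M1 f v x - nnfft_s1N phi1 phi2 N1 N2 m1 M1 sigma1 f v x / hat phi1 (N%:R * x)
  = - (((A1 w)^-1)%:C * (\sum_(k <- I_ M1) f k * (Q k - (A1 w)%:C * expi (- (2 * pi * N%:R * v k * x))))
    + (N1%:R / A1 w)%:C * \sum_(l <- I_ (N1 + 2 * m1)) g l * (q l - e l)).
  rewrite sE hatE.
  have -> : \sum_(k <- I_ M1) f k * (Q k - (A1 w)%:C * expi (- (2 * pi * N%:R * v k * x)))
     = \sum_(k <- I_ M1) f k * Q k - (A1 w)%:C * exp_sum N M1 f v x.
    rewrite /exp_sum mulr_sumr -sumrB; apply: eq_bigr => k _.
    by rewrite mulrBr; congr (_ - _); rewrite mulrCA.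
  rewrite (rmorphM _ N1%:R) !fmorphV rmorph_nat.
  move: (\sum_(k <- _) _) (\sum_(l <- _) _) (exp_sum _ _ _ _ _) => X Y Z.
  by field; rewrite NC A0C.
rewrite /nnfft_error errE cabsN; apply: le_trans (cabsD _ _) _.
have Sf0 : 0 <= Sf by rewrite /Sf sumr_ge0// => k _; exact: cabs_ge0.
have eps2_ge0 : 0 <= eps2 by rewrite /eps2 /alias_eps mulr_ge0 ?expR_ge0// addr_ge0// mulr_ge0// powR_ge0.
have B1 : cabs (((A1 w)^-1)%:C * (\sum_(k <- I_ M1) f k *
    (Q k - (A1 w)%:C * expi (- (2 * pi * N%:R * v k * x))))) <= eps1 * Sf.
  rewrite cabsM cabs_real ger0_norm ?invr_ge0 ?(ltW A0)// mulrC ler_pdivrMr//.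
  apply: le_trans (cabs_sum _ _) _; rewrite [leRHS]mulrAC mulr_sumr big_seq [leRHS]big_seq.
  apply: ler_sum => k kI; rewrite cabsM mulrC ler_wpM2r ?cabs_ge0//; exact: HQ.
have B2 : cabs ((N1%:R / A1 w)%:C * \sum_(l <- I_ (N1 + 2 * m1)) g l * (q l - e l)) <=
   (2 * m1%:R + 1) / A1 w * eps2 * Sf.
  have NA0 : 0 <= N1%:R / A1 w by rewrite divr_ge0// ltW.
  rewrite cabsM cabs_real ger0_norm//.
  apply: (@le_trans _ _ (N1%:R / A1 w * (N1%:R^-1 * ((2 * m1%:R + 1) * Sf) * eps2))).
    rewrite ler_wpM2l//; apply: le_trans (cabs_sum _ _) _.
    apply: (@le_trans _ _ (\sum_(l <- I_ (N1 + 2 * m1)) cabs (g l) * eps2)).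
      rewrite big_seq [leRHS]big_seq; apply: ler_sum => l lI.
      by rewrite cabsM ler_wpM2l ?cabs_ge0//; exact: Hq.
    by rewrite -mulr_suml ler_wpM2r//; exact: sum_g_le.
  rewrite le_eqVlt; apply/orP; left; apply/eqP; field.
  by rewrite !gt_eqF.
have K := ler_wpM2r Sf0 (ler_wpM2r eps2_ge0 (step_factor xb)).
apply: le_trans (lerD B1 (le_trans B2 K)) _.
rewrite le_eqVlt; apply/orP; left; apply/eqP.
by rewrite /E_sinh /eps1 /eps2 /alias_eps; ring.
Qed.

End Assembly.

(** * Continuity of the error and the final estimate *)

Section ErrorContinuity.
Context {R : realType}.

Definition ccontinuous (F : R -> R[i]) :=
  continuous (fun x => complex.Re (F x)) /\ continuous (fun x => complex.Im (F x)).

Lemma ccontinuous_cst (z : R[i]) : ccontinuous (fun=> z).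
Proof. by split; exact: contc. Qed.

Lemma ccontinuousM (F G : R -> R[i]) : ccontinuous F -> ccontinuous G ->
  ccontinuous (fun x => F x * G x).
Proof.
move=> [F1 F2] [G1 G2]; split.
  rewrite (_ : (fun _ => _) = fun x => complex.Re (F x) * complex.Re (G x)
    - complex.Im (F x) * complex.Im (G x)); first by cont.
  by apply/funext => x; case: (F x) => a b; case: (G x).
rewrite (_ : (fun _ => _) = fun x => complex.Re (F x) * complex.Im (G x)
  + complex.Im (F x) * complex.Re (G x)); first by cont.
by apply/funext => x; case: (F x) => a b; case: (G x).
Qed.

Lemma ccontinuous_sum (I : Type) (s : seq I) (F : I -> R -> R[i]) :
  (forall i, ccontinuous (F i)) -> ccontinuous (fun x => \sum_(i <- s) F i x).
Proof.
move=> cF; elim: s => [|i s [IH1 IH2]].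
  by under eq_fun do rewrite big_nil; exact: ccontinuous_cst.
under eq_fun do rewrite big_cons.
have [F1 F2] := cF i; split.
  rewrite (_ : (fun _ => _) = fun x => complex.Re (F i x)
    + complex.Re (\sum_(j <- s) F j x)); first by cont.
  by apply/funext => x; case: (F i x) => a b; case: (\sum_(j <- s) F j x).
rewrite (_ : (fun _ => _) = fun x => complex.Im (F i x)
  + complex.Im (\sum_(j <- s) F j x)); first by cont.
by apply/funext => x; case: (F i x) => a b; case: (\sum_(j <- s) F j x).
Qed.

Lemma ccontinuous_expi (h : R -> R) : continuous h -> ccontinuous (fun x => expi (h x)).
Proof. by move=> ch; split; rewrite /expi /=; cont. Qed.

Lemma ccontinuous_real (h : R -> R) : continuous h -> ccontinuous (fun x => (h x)%:C).
Proof. by move=> ch; split => //=; exact: contc. Qed.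

Lemma cabs_sub_div_cont (F G : R -> R[i]) (h : R -> R) (x : R) :
  ccontinuous F -> ccontinuous G -> continuous h -> h x != 0 ->
  {for x, continuous (fun y => cabs (F y - G y / (h y)%:C))}.
Proof.
move=> [F1 F2] [G1 G2] ch hx.
have -> : (fun y => cabs (F y - G y / (h y)%:C)) = (fun y => Num.sqrt
   ((complex.Re (F y) - complex.Re (G y) * (h y)^-1) * (complex.Re (F y) - complex.Re (G y) * (h y)^-1)
  + (complex.Im (F y) - complex.Im (G y) * (h y)^-1) * (complex.Im (F y) - complex.Im (G y) * (h y)^-1))).
  apply/funext => y; rewrite -!expr2 /cabs -fmorphV.
  case: (F y) => a b; case: (G y) => c d /=.
  by congr (Num.sqrt (_ ^+ 2 + _ ^+ 2)); ring.
have cV : (h y)^-1 @[y --> x] --> (h x)^-1 by apply: cvgV => //; exact: ch.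
have re : complex.Re (F y) - complex.Re (G y) * (h y)^-1 @[y --> x]
    --> complex.Re (F x) - complex.Re (G x) * (h x)^-1.
  by apply: cvgB; [exact: F1|apply: cvgM => //; exact: G1].
have im : complex.Im (F y) - complex.Im (G y) * (h y)^-1 @[y --> x]
    --> complex.Im (F x) - complex.Im (G x) * (h x)^-1.
  by apply: cvgB; [exact: F2|apply: cvgM => //; exact: G2].
apply: continuous_cvg; first exact: sqrt_continuous.
by apply: cvgD; apply: cvgM.
Qed.

Lemma exists_max_seq (s : seq int) (F : int -> R) : (0 < size s)%N ->
  exists2 j, j \in s & forall i, i \in s -> F i <= F j.
Proof.
elim: s => // a [|b s] IH _.
  by exists a; rewrite ?mem_head// => i; rewrite inE => /eqP ->.
have [//|j js H] := IH.
have [le|le] := leP (F a) (F j).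
  exists j; first by rewrite inE js orbT.
  by move=> i; rewrite inE => /orP[/eqP ->//|]; exact: H.
exists a; first exact: mem_head.
move=> i; rewrite inE => /orP[/eqP ->//|/H Hi]; exact: le_trans Hi (ltW le).
Qed.

End ErrorContinuity.

Unset Implicit Arguments.

Theorem theorem4p1 (R : realType)
    (N N1 N2 m1 m2 M1 M2 : nat) (sigma1 sigma2 : R)
    (N_gt0 : (0 < N)%N)
    (N1_gt0 : (0 < N1)%N) (N1_even : ~~ odd N1)
    (N1E : N1%:R = sigma1 * N%:R)
    (sigma1_bnd : 5 / 4 <= sigma1 <= 2)
    (m1_gt0 : (0 < m1)%N) (m1_neq1 : m1 <> 1%N)
    (m1_N1 : (2 * m1 < N1)%N)
    (N2_gt0 : (0 < N2)%N) (N2_even : ~~ odd N2)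
    (N2E : N2%:R = sigma2 * (N1 + 2 * m1)%:R)
    (sigma2_bnd : 5 / 4 <= sigma2 <= 2)
    (m2_gt0 : (0 < m2)%N) (m2_neq1 : m2 <> 1%N)
    (m2_N2 : (2 * m2)%:R <= (1 - 1 / sigma1) * N2%:R)
    (m1_le_m2 : (m1 <= m2)%N)
    (M1_gt0 : (0 < M1)%N) (M1_even : ~~ odd M1)
    (M2_gt0 : (0 < M2)%N) (M2_even : ~~ odd M2)
    (x : int -> R)
    (x_bnd : forall j, j \in I_ M2 -> -(1 / 2) <= x j <= 1 / 2)
    (f : int -> R[i]) (v : int -> R) :
  let a : R := 1 + 2 * m1%:R / N1%:R in
  let err : R -> R :=
    nnfft_error (phi_sinh N1 m1 sigma1) (phi_sinh N2 m2 sigma2)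
      N N1 N2 m1 M1 sigma1 f v in
  (forall k, k \in I_ M1 -> - (1 / (2 * a)) <= v k <= 1 / (2 * a)) ->
  exists max_nodes max_all : R,
    [/\ is_max [set err (x j) | j in [set` I_ M2]] max_nodes,
        is_max [set err y | y in [set y : R | - (1 / 2) <= y <= 1 / 2]] max_all,
        max_nodes <= max_all &
        max_all <= E_sinh N1 m1 m2 sigma1 sigma2 *
                     \sum_(k <- I_ M1) cabs (f k)].
Proof.
move=> a err v_bnd.
have m1_gt1 : (2 <= m1)%N by rewrite ltn_neqAle m1_gt0 andbT eq_sym; apply/eqP.
have m2_gt1 : (2 <= m2)%N by rewrite ltn_neqAle m2_gt0 andbT eq_sym; apply/eqP.
have N1R : 0 < N1%:R :> R by rewrite ltr0n.
have sigma1_gt0 : 0 < sigma1 by case/andP: sigma1_bnd => h _; lra.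
have a_ge1 : 1 <= a by rewrite /a lerDl divr_ge0 ?(ltW N1R)// mulr_ge0.
have a_gt0 : 0 < a by exact: lt_le_trans a_ge1.
have v_half k : k \in I_ M1 -> `|v k| <= 1 / 2.
  move=> /v_bnd; rewrite -ler_norml => vk; apply: le_trans vk _.
  by rewrite !div1r invfM ler_piMr ?invr_ge0// invf_le1.
have err_le := @nnfft_error_le R N N1 N2 m1 m2 M1 sigma1 sigma2 N_gt0 N1_gt0
  N1_even N1E sigma1_bnd m1_gt1 m1_N1 N2_gt0 N2_even N2E sigma2_bnd m2_gt1 m2_N2
  f v v_half.
pose h y : R := wft m1 sigma1 (N%:R * y / N1%:R) / N1%:R.
have ch : continuous h.
  by have cw := @wft_cont R m1 sigma1; rewrite /h; cont.
have cphi2 : continuous (phi_sinh N2 m2 sigma2).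
  by have co := @omega_sinh_cont R m2 sigma2; rewrite /phi_sinh; cont.
have errE : err = (fun y => cabs (exp_sum N M1 f v y
    - nnfft_s1N (phi_sinh N1 m1 sigma1) (phi_sinh N2 m2 sigma2) N1 N2 m1 M1 sigma1 f v y
      / (h y)%:C)).
  by apply/funext => y; rewrite /err /nnfft_error hat_phi_sinh.
have h_gt0 y : - (1 / 2) <= y <= 1 / 2 -> 0 < h y.
  move=> yb; rewrite /h divr_gt0//; apply: (wft_gt0 m1_gt1 sigma1_bnd).
  have -> : N%:R * y / N1%:R = y / sigma1.
    by rewrite N1E; field; rewrite !gt_eqF// ltr0n.
  rewrite -ler_norml normrM normfV (gtr0_norm sigma1_gt0) ler_pdivrMr//.
  have yn : `|y| <= 1 / 2 by rewrite ler_norml.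
  by rewrite (_ : 1 / (2 * sigma1) * sigma1 = 1 / 2)//; field; rewrite gt_eqF.
have err_cont : {within `[- (1 / 2), 1 / 2], continuous err}.
  apply: continuous_in_subspaceT => y; rewrite inE/= in_itv/= => yb.
  rewrite errE; apply: cabs_sub_div_cont => //.
  - apply: ccontinuous_sum => k; apply: ccontinuousM; first exact: ccontinuous_cst.
    by apply: ccontinuous_expi; cont.
  - apply: ccontinuous_sum => s; apply: ccontinuousM; first exact: ccontinuous_cst.
    by apply: ccontinuous_real; cont.
  - by rewrite gt_eqF// h_gt0.
have h12 : - (1 / 2) <= 1 / 2 :> R by lra.
have [c cI cmax] := EVT_max h12 err_cont.
have cb : - (1 / 2) <= c <= 1 / 2 by move: cI; rewrite in_itv.
have sz : (0 < size (I_ M2))%N by rewrite size_map size_iota.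
have [j jI jmax] := exists_max_seq (fun j => err (x j)) sz.
have all_le y : - (1 / 2) <= y <= 1 / 2 -> err y <= err c.
  by move=> yb; apply: cmax; rewrite in_itv.
exists (err (x j)), (err c); split.
- split; first by exists j.
  by move=> _ [i iI <-]; exact: jmax.
- split; first by exists c.
  by move=> _ [y yb <-]; exact: all_le.
- exact/all_le/x_bnd.
- exact: err_le.
Qed.
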